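(* Let $i\colon A\to X$ be a cofibration of directed graphs and let $f\colon A\to Y$ be an arbitrary map of directed graphs. Form the pushout $X\cup_A Y$ in the category of directed graphs, with canonical maps $g\colon X\to X\cup_A Y$ and $j\colon Y\to X\cup_A Y$. Then for all $r\geq 1$ the induced map $$E^r_{*,*}(X,A)\longrightarrow E^r_{*,*}(X\cup_A Y,Y)$$ is an isomorphism. In particular, the induced maps on magnitude homology and bigraded path homology $$\mathrm{MH}_{*,*}(X,A)\to\mathrm{MH}_{*,*}(X\cup_A Y,Y),\qquad \mathrm{PH}_{*,*}(X,A)\to\mathrm{PH}_{*,*}(X\cup_A Y,Y)$$ are isomorphisms.
   Context: Fix a commutative ground ring $R$. A directed graph $G$ has a vertex set $V(G)$ and edge set $E(G)\subseteq V(G)\times V(G)$ (loops allowed). A map of directed graphs $G\to H$ is a function $f\colon V(G)\to V(H)$ such that for each edge $x\to y$ of $G$ either $f(x)=f(y)$ or $f(x)\to f(y)$ is an edge of $H$. The resulting category is cocomplete. The distance $d(x,y)\in\{0,1,\dots,\infty\}$ is the minimal number of edges in a directed path from $x$ to $y$. Cofibrations: for a subgraph $A\subseteq X$, the reach $rA$ is the induced subgraph of $X$ on all vertices that admit a directed path from some vertex of $A$. A cofibration is an induced subgraph inclusion $A\hookrightarrow X$ such that (1) there are no edges from vertices not in $A$ to vertices in $A$; and (2) for each $x\in rA$ there is a vertex $\pi(x)\in A$ with $d(a,x)=d(a,\pi(x))+d(\pi(x),x)$ for every $a\in A$. It is known that cofibrations are closed under pushout, so $j$ is a cofibration; $Y$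 is regarded as a subgraph of $X\cup_AY$ via $j$. The reachability complex $\mathrm{RC}_*(G)$ has in degree $k$ the free $R$-module on tuples $(x_0,\dots,x_k)$ of vertices with consecutive entries distinct and $d(x_i,x_{i+1})<\infty$ for all $i$; its differential is $\partial(x_0,\dots,x_k)=\sum_{i=0}^k(-1)^i(x_0,\dots,\widehat{x_i},\dots,x_k)$, omitting terms with repeated consecutive entries. The length of a tuple is $\ell(x_0,\dots,x_k)=\sum_i d(x_i,x_{i+1})$, and $F_\ell\mathrm{RC}_*(G)$ is spanned by tuples of length at most $\ell$. For a subgraph $A\subseteq X$, $\mathrm{RC}(X,A)=\mathrm{RC}(X)/\mathrm{RC}(A)$ with $F_\ell\mathrm{RC}(X,A)$ the image of $F_\ell\mathrm{RC}(X)$. The relative magnitude-path spectral sequence $\{E^r_{*,*}(X,A),d^r\}_{r\geq0}$ is the spectral sequence of this filtered complex, with $E^0_{i,j}=F_i\mathrm{RC}_{i+j}/F_{i-1}\mathrm{RC}_{i+j}$ and $d^r$ of bidegree $(-r,r-1)$. One sets $\mathrm{MH}_{k,\ell}(X,A)=E^1_{\ell,k-\ell}(X,A)$ and $\mathrm{PH}_{k,\ell}(X,A)=E^2_{\ell,k-\ell}(X,A)$. The map in the claim is induced by $g$, viewed as a map of pairs $(X,A)\to(X\cup_AY,Y)$. *)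

(* Defs.v *)
From HB Require Import structures.
From mathcomp Require Import all_boot all_order all_algebra.
From mathcomp Require Import boolp.
From mathcomp Require Import finmap monalg.
From mathcomp Require Import zify.

Set Implicit Arguments.
Unset Strict Implicit.
Unset Printing Implicit Defensive.

Import Order.TTheory GRing.Theory Num.Theory.

Local Open Scope ring_scope.
Local Open Scope quotient_scope.

Section Submodules.
Variables (R : pzRingType) (V : lmodType R) (W : submodClosed V).

Record subm := Subm { subm_val : V; _ : subm_val \in W }.

HB.instance Definition _ := [isSub of subm for subm_val].
HB.instance Definition _ := [Choice of subm by <:].
HB.instance Definition _ := [SubChoice_isSubLmodule of subm by <:].

(* a copy of W carrying the zmodClosed structure needed by {ideal_quot _} *)
Definition zmod_pred : {pred V} := W.
HB.instance Definition _ := GRing.isZmodClosed.Build V zmod_pred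
  (GRing.subsemimod_closedB (GRing.subsemimodClosedP W)).

Definition lquot := {ideal_quot zmod_pred}.
HB.instance Definition _ := GRing.Zmodule.on lquot.
HB.instance Definition _ := Quotient.on lquot.

Lemma lquotP (x y : V) :
  reflect (\pi_lquot x = \pi_lquot y) (x - y \in W).
Proof. by rewrite (Quotient.idealrBE zmod_pred); apply: eqP. Qed.

Lemma lquotD (x y : V) : \pi_lquot (x + y) = \pi_lquot x + \pi_lquot y.
Proof. exact: Quotient.pi_add. Qed.

Definition lquot_scale (a : R) (x : lquot) : lquot := \pi_lquot (a *: repr x).

Lemma lquot_scaleE a (x : V) :
  lquot_scale a (\pi_lquot x) = \pi_lquot (a *: x).
Proof.
apply/lquotP; rewrite -scalerBr rpredZ //.
by apply/lquotP; rewrite reprK.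
Qed.

Lemma lquot_scaleA a b x :
  lquot_scale a (lquot_scale b x) = lquot_scale (a * b) x.
Proof.
by elim/quotW: x => x; rewrite (lquot_scaleE b x) !lquot_scaleE scalerA.
Qed.

Lemma lquot_scale1 : left_id 1 lquot_scale.
Proof. by elim/quotW => x; rewrite lquot_scaleE scale1r. Qed.

Lemma lquot_scaleDr : right_distributive lquot_scale +%R.
Proof.
move=> a; elim/quotW => x; elim/quotW => y.
by rewrite -lquotD !lquot_scaleE scalerDr lquotD.
Qed.

Lemma lquot_scaleDl x : {morph lquot_scale^~ x : a b / a + b}.
Proof.
by elim/quotW: x => x a b; rewrite !lquot_scaleE scalerDl lquotD.
Qed.

HB.instance Definition _ := GRing.Zmodule_isLmodule.Build R lquot
  lquot_scaleA lquot_scale1 lquot_scaleDr lquot_scaleDl.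

Lemma lquotZ a (x : V) : \pi_lquot (a *: x) = a *: \pi_lquot x.
Proof. exact: esym (lquot_scaleE a x). Qed.

End Submodules.

Arguments subm_val {R V W}.

Section LinearMaps.
Variables (R : pzRingType) (U V : lmodType R) (f : {linear U -> V}).

Definition range_pred : {pred V} := fun y => `[< exists x, y = f x >].

Lemma range_subproof : GRing.subsemimod_closed range_pred.
Proof.
split; first split; first by apply/asboolP; exists 0; rewrite linear0.
- move=> _ _ /asboolP[x ->] /asboolP[y ->]; apply/asboolP.
  by exists (x + y); rewrite linearD.
- move=> a _ /asboolP[x ->]; apply/asboolP.
  by exists (a *: x); rewrite linearZ.
Qed.
HB.instance Definition _ :=
  GRing.isSubmodClosed.Build R V range_pred range_subproof.

Variables (S : submodClosed U) (T : submodClosed V).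

Definition image_pred : {pred V} :=
  fun y => `[< exists2 x, x \in S & y = f x >].

Lemma image_subproof : GRing.subsemimod_closed image_pred.
Proof.
split; first split; first by apply/asboolP; exists 0; rewrite ?rpred0 ?linear0.
- move=> _ _ /asboolP[x Sx ->] /asboolP[y Sy ->]; apply/asboolP.
  by exists (x + y); rewrite ?rpredD ?linearD.
- move=> a _ /asboolP[x Sx ->]; apply/asboolP.
  by exists (a *: x); rewrite ?rpredZ ?linearZ.
Qed.
HB.instance Definition _ :=
  GRing.isSubmodClosed.Build R V image_pred image_subproof.

Hypothesis fST : forall x, x \in S -> f x \in T.

Definition subm_fun (x : subm S) : subm T := Subm (fST (valP x)).

Lemma subm_fun_linear : linear subm_fun.
Proof. by move=> a x y; apply: val_inj; rewrite /= linearP. Qed.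
HB.instance Definition _ :=
  GRing.isLinear.Build R (subm S) (subm T) _ subm_fun subm_fun_linear.
Definition subm_map : {linear subm S -> subm T} := subm_fun.

Definition lquot_fun (x : lquot S) : lquot T := \pi_(lquot T) (f (repr x)).

Lemma lquot_funE (x : U) : lquot_fun (\pi_(lquot S) x) = \pi_(lquot T) (f x).
Proof.
apply/lquotP; rewrite -linearB fST //.
by apply/lquotP; rewrite reprK.
Qed.

Lemma lquot_fun_linear : linear lquot_fun.
Proof.
move=> a; elim/quotW => x; elim/quotW => y.
by rewrite -lquotZ -lquotD !lquot_funE linearP lquotD lquotZ.
Qed.
HB.instance Definition _ :=
  GRing.isLinear.Build R (lquot S) (lquot T) _ lquot_fun lquot_fun_linear.
Definition lquot_map : {linear lquot S -> lquot T} := lquot_fun.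

Lemma lquot_mapE (x : U) : lquot_map (\pi_(lquot S) x) = \pi_(lquot T) (f x).
Proof. exact: lquot_funE. Qed.

End LinearMaps.

Section Projection.
Variables (R : pzRingType) (V : lmodType R) (W : submodClosed V).
Definition lquot_pi (x : V) : lquot W := \pi_(lquot W) x.
Lemma lquot_pi_linear : linear lquot_pi.
Proof. by move=> a x y; rewrite /lquot_pi lquotD lquotZ. Qed.
HB.instance Definition _ :=
  GRing.isLinear.Build R V (lquot W) _ lquot_pi lquot_pi_linear.
End Projection.

Section FreeModule.
Variables (R : pzRingType) (K : choiceType).

(* monalg makes {malg R[K]} a module only over nontrivial rings *)
Definition freemod := {malg R[K]}.
HB.instance Definition _ := GRing.Zmodule.on freemod.

Definition freemod_scale (a : R) (x : freemod) : freemod :=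
  \sum_(k <- msupp x) << a * x@_k *g k >>.

Lemma freemod_scaleE a x k : (freemod_scale a x)@_k = a * x@_k.
Proof.
rewrite {2}[x]monalgE !raddf_sum mulr_sumr.
by apply/eq_bigr=> /= i _; rewrite !mcoeffU mulrnAr.
Qed.

Lemma freemod_scaleA a b x :
  freemod_scale a (freemod_scale b x) = freemod_scale (a * b) x.
Proof. by apply/malgP=> k; rewrite !freemod_scaleE mulrA. Qed.

Lemma freemod_scale1 : left_id 1 freemod_scale.
Proof. by move=> x; apply/malgP=> k; rewrite !freemod_scaleE mul1r. Qed.

Lemma freemod_scaleDr : right_distributive freemod_scale +%R.
Proof.
by move=> a x y; apply/malgP=> k; rewrite !(mcoeffD, freemod_scaleE) mulrDr.
Qed.

Lemma freemod_scaleDl x : {morph freemod_scale^~ x : a b / a + b}.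
Proof.
by move=> a b; apply/malgP=> k; rewrite !(mcoeffD, freemod_scaleE) mulrDl.
Qed.

HB.instance Definition _ := GRing.Zmodule_isLmodule.Build R freemod
  freemod_scaleA freemod_scale1 freemod_scaleDr freemod_scaleDl.

Lemma freemodZE a (x : freemod) k : (a *: x)@_k = a * x@_k.
Proof. exact: freemod_scaleE. Qed.

Definition gen (k : K) : freemod := << (1 : R) *g k >>.

Lemma freemodE (x : freemod) : x = \sum_(k <- msupp x) x@_k *: gen k.
Proof.
rewrite {1}[x]monalgE; apply: eq_bigr => k _; apply/malgP => l.
by rewrite freemodZE !mcoeffU mulrnAr mulr1.
Qed.

Section Lift.
Variables (M : lmodType R) (h : K -> M).

Definition free_lift_fun (x : freemod) : M :=
  \sum_(k <- msupp x) x@_k *: h k.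

Lemma free_lift_funEw (d : {fset K}) (x : freemod) : {subset msupp x <= d} ->
  free_lift_fun x = \sum_(k <- d) x@_k *: h k.
Proof.
move=> sxd; rewrite /free_lift_fun [RHS](bigID (mem (msupp x))) /=.
rewrite [X in _ + X]big1 ?addr0; last first.
  by move=> k kx; rewrite mcoeff_outdom ?scale0r.
rewrite -[RHS]big_filter; apply: perm_big; apply: uniq_perm => //.
  by rewrite filter_uniq.
move=> k; rewrite mem_filter /=; case kx: (k \in msupp x) => //=.
by rewrite sxd.
Qed.

Lemma free_lift_fun_linear : linear free_lift_fun.
Proof.
move=> a x y; set d := (msupp x `|` msupp y `|` msupp (a *: x + y))%fset.
rewrite !(@free_lift_funEw d); last 3 first.
- by move=> k kx; rewrite !in_fsetE kx ?orbT.
- by move=> k kx; rewrite !in_fsetE kx ?orbT.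
- by move=> k kx; rewrite !in_fsetE kx ?orbT.
rewrite scaler_sumr -big_split; apply: eq_bigr => k _ /=.
by rewrite mcoeffD freemodZE scalerDl scalerA.
Qed.
HB.instance Definition _ :=
  GRing.isLinear.Build R freemod M _ free_lift_fun free_lift_fun_linear.
Definition free_lift : {linear freemod -> M} := free_lift_fun.

Lemma free_lift_gen k : free_lift (gen k) = h k.
Proof.
rewrite /= (@free_lift_funEw [fset k]%fset); last first.
  by move=> l /(fsubsetP msuppU_le).
by rewrite big_seq_fset1 mcoeffUU scale1r.
Qed.
End Lift.

Lemma freemod_ext (M : lmodType R) (u v : {linear freemod -> M}) :
  (forall k, u (gen k) = v (gen k)) -> u =1 v.
Proof.
move=> uv x; rewrite [x]freemodE !linear_sum; apply: eq_bigr => k _.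
by rewrite !linearZ uv.
Qed.

Lemma freemod_ext2 (M M' N : lmodType R)
    (u : {linear freemod -> M}) (v : {linear freemod -> M'})
    (u' : {linear M -> N}) (v' : {linear M' -> N}) :
  (forall k, u' (u (gen k)) = v' (v (gen k))) -> forall x, u' (u x) = v' (v x).
Proof.
move=> uv x; rewrite [x]freemodE !linear_sum; apply: eq_bigr => k _.
by rewrite !linearZ uv.
Qed.

End FreeModule.

Arguments gen {R K}.

(* Homologically graded complexes indexed by all integers, with an increasing
   filtration; d n m is the differential from degree n to degree m, which is
   zero unless m = n - 1, so that no casts between degrees are needed. *)
Record fcomplex (R : pzRingType) := FComplex {
  fc_obj :> int -> lmodType R;
  fc_d : forall n m, {linear fc_obj n -> fc_obj m};
  fc_F : int -> forall n, submodClosed (fc_obj n);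
  fc_shape : forall n m, n != m + 1 -> forall x, fc_d n m x = 0;
  fc_dd : forall n m k x, fc_d m k (fc_d n m x) = 0;
  fc_Fmono : forall p q n x, p <= q -> x \in fc_F p n -> x \in fc_F q n;
  fc_Fd : forall p n m x, x \in fc_F p n -> fc_d n m x \in fc_F p m
}.

Record fcmap (R : pzRingType) (C D : fcomplex R) := FCMap {
  fcm_fun :> forall n, {linear C n -> D n};
  fcm_d : forall n m x, fcm_fun m (fc_d C n m x) = fc_d D n m (fcm_fun n x);
  fcm_F : forall p n x, x \in fc_F C p n -> fcm_fun n x \in fc_F D p n
}.

Section Cokernel.
Variables (R : pzRingType) (C D : fcomplex R) (u : fcmap C D).

Definition coker_obj (n : int) : lmodType R := lquot (range_pred (u n)).

Lemma coker_d_subproof n m x :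
  x \in range_pred (u n) -> fc_d D n m x \in range_pred (u m).
Proof.
case/asboolP=> y ->; apply/asboolP; exists (fc_d C n m y).
by rewrite fcm_d.
Qed.

Definition coker_d n m : {linear coker_obj n -> coker_obj m} :=
  lquot_map (@coker_d_subproof n m).

Definition coker_F (p n : int) : submodClosed (coker_obj n) :=
  image_pred (lquot_pi (range_pred (u n))) (fc_F D p n).

Lemma coker_shape n m : n != m + 1 -> forall x, coker_d n m x = 0.
Proof.
move=> nm; elim/quotW => x; rewrite lquot_mapE fc_shape //.
exact: (linear0 (lquot_pi _)).
Qed.

Lemma coker_dd n m k x : coker_d m k (coker_d n m x) = 0.
Proof.
elim/quotW: x => x; rewrite (lquot_mapE (@coker_d_subproof n m)) lquot_mapE.
by rewrite fc_dd; apply: (linear0 (lquot_pi _)).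
Qed.

Lemma coker_Fmono p q n x : p <= q -> x \in coker_F p n -> x \in coker_F q n.
Proof.
move=> pq /asboolP[y yF ->]; apply/asboolP; exists y => //.
exact: fc_Fmono pq yF.
Qed.

Lemma coker_Fd p n m x : x \in coker_F p n -> coker_d n m x \in coker_F p m.
Proof.
case/asboolP=> y yF ->; apply/asboolP; exists (fc_d D n m y).
  exact: fc_Fd.
exact: lquot_mapE.
Qed.

Definition coker : fcomplex R :=
  FComplex coker_shape coker_dd coker_Fmono coker_Fd.

End Cokernel.

Section CokernelMap.
Variables (R : pzRingType) (C D C' D' : fcomplex R).
Variables (u : fcmap C D) (u' : fcmap C' D') (v : fcmap C C') (w : fcmap D D').
Hypothesis sq : forall n x, w n (u n x) = u' n (v n x).

Lemma coker_map_subproof n x :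
  x \in range_pred (u n) -> w n x \in range_pred (u' n).
Proof. by case/asboolP=> y ->; apply/asboolP; exists (v n y); rewrite sq. Qed.

Definition coker_map_fun n : {linear coker u n -> coker u' n} :=
  lquot_map (@coker_map_subproof n).

Lemma coker_map_d n m x :
  coker_map_fun m (fc_d (coker u) n m x) =
  fc_d (coker u') n m (coker_map_fun n x).
Proof.
elim/quotW: x => x; rewrite /= (lquot_mapE (@coker_d_subproof _ _ _ u n m)).
rewrite (lquot_mapE (@coker_map_subproof n)) (lquot_mapE (@coker_map_subproof m)).
by rewrite (lquot_mapE (@coker_d_subproof _ _ _ u' n m)) fcm_d.
Qed.

Lemma coker_map_F p n x :
  x \in fc_F (coker u) p n -> coker_map_fun n x \in fc_F (coker u') p n.
Proof.
case/asboolP=> y yF ->; apply/asboolP; exists (w n y); first exact: fcm_F.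
exact: lquot_mapE.
Qed.

Definition coker_map : fcmap (coker u) (coker u') :=
  FCMap coker_map_d coker_map_F.

End CokernelMap.

Section SpectralSequence.
Variables (R : pzRingType) (C : fcomplex R).

Definition Zpage_pred (r p n : int) : {pred C n} :=
  fun x => (x \in fc_F C p n) &&
           `[< forall m, fc_d C n m x \in fc_F C (p - r) m >].
Arguments Zpage_pred : clear implicits.

Lemma Zpage_subproof r p n : GRing.subsemimod_closed (Zpage_pred r p n).
Proof.
split; first split.
- rewrite unfold_in rpred0; apply/asboolP => m.
  by rewrite linear0 rpred0.
- move=> x y /andP[xF /asboolP dx] /andP[yF /asboolP dy].
  apply/andP; split; first exact: rpredD.
  by apply/asboolP => m; rewrite linearD rpredD.
- move=> a x /andP[xF /asboolP dx].
  apply/andP; split; first exact: rpredZ.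
  by apply/asboolP => m; rewrite linearZ; apply: rpredZ; apply: dx.
Qed.
HB.instance Definition _ r p n :=
  GRing.isSubmodClosed.Build R (C n) (Zpage_pred r p n)
    (Zpage_subproof r p n).
Definition Zpage r p n : submodClosed (C n) := Zpage_pred r p n.

Definition Bpage_pred (r p n : int) : {pred subm (Zpage r p n)} :=
  fun z => `[< exists y w, [/\ y \in Zpage (r - 1) (p - 1) n,
                 w \in Zpage (r - 1) (p + r - 1) (n + 1)
               & subm_val z = y + fc_d C (n + 1) n w] >].
Arguments Bpage_pred : clear implicits.

Lemma Bpage_subproof r p n : GRing.subsemimod_closed (Bpage_pred r p n).
Proof.
split; first split.
- apply/asboolP; exists 0, 0; split; rewrite ?rpred0 //.
  by rewrite linear0 addr0.
- move=> z1 z2 /asboolP[y1 [w1 [y1Z w1Z e1]]] /asboolP[y2 [w2 [y2Z w2Z e2]]].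
  apply/asboolP; exists (y1 + y2), (w1 + w2); split; rewrite ?rpredD //.
  by rewrite [LHS](_ : _ = subm_val z1 + subm_val z2) // e1 e2 addrACA linearD.
- move=> a z /asboolP[y [w [yZ wZ e]]].
  apply/asboolP; exists (a *: y), (a *: w); split; rewrite ?rpredZ //.
  by rewrite [LHS](_ : _ = a *: subm_val z) // e scalerDr linearZ.
Qed.
HB.instance Definition _ r p n :=
  GRing.isSubmodClosed.Build R (subm (Zpage r p n)) (Bpage_pred r p n)
    (Bpage_subproof r p n).
Definition Bpage r p n : submodClosed (subm (Zpage r p n)) :=
  Bpage_pred r p n.

(* E^r_{p,q} = Z^r_p / (Z^{r-1}_{p-1} + d Z^{r-1}_{p+r-1}) in total degree
   p + q, where Z^r_p = F_p \cap d^{-1} F_{p-r}; for r = 0 this is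
   F_p / F_{p-1}. *)
Definition Epage (r : nat) (p q : int) : lmodType R :=
  lquot (Bpage r%:Z p (p + q)).

End SpectralSequence.

Section SpectralSequenceMap.
Variables (R : pzRingType) (C D : fcomplex R) (u : fcmap C D).

Lemma Zpage_map_subproof r p n x : x \in Zpage C r p n -> u n x \in Zpage D r p n.
Proof.
case/andP=> xF /asboolP dx; apply/andP; split; first exact: fcm_F.
by apply/asboolP => m; rewrite -fcm_d; apply: fcm_F; apply: dx.
Qed.

Definition Zpage_map r p n :
    {linear subm (Zpage C r p n) -> subm (Zpage D r p n)} :=
  subm_map (@Zpage_map_subproof r p n).

Lemma Epage_map_subproof r p n z :
  z \in Bpage C r p n -> Zpage_map r p n z \in Bpage D r p n.
Proof.
case/asboolP=> y [w [yZ wZ e]]; apply/asboolP.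
exists (u n y), (u (n + 1) w); split; rewrite ?Zpage_map_subproof //.
by rewrite /= -fcm_d -linearD -e.
Qed.

Definition Epage_map (r : nat) (p q : int) :
    {linear Epage C r p q -> Epage D r p q} :=
  lquot_map (@Epage_map_subproof r%:Z p (p + q)).

End SpectralSequenceMap.

Record digraph := Digraph { vert :> choiceType; edge : rel vert }.

Record dhom (G H : digraph) := DHom {
  dhom_fun :> G -> H;
  dhomP : forall x y, edge x y ->
    (dhom_fun x == dhom_fun y) || edge (dhom_fun x) (dhom_fun y)
}.

(* Extended natural numbers: None stands for infinity. *)
Definition eadd (a b : option nat) : option nat :=
  if (a, b) is (Some m, Some n) then Some (m + n)%N else None.

Definition ele (a b : option nat) : bool :=
  if b is Some n then (if a is Some m then (m <= n)%N else false) else true.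

Definition eleZ (a : option nat) (p : int) : bool :=
  if a is Some n then n%:Z <= p else false.

Lemma ele_trans : transitive ele.
Proof.
by move=> [b|] [a|] [c|] //=; apply: leq_trans.
Qed.

Lemma ele_refl : reflexive ele.
Proof. by move=> [a|] /=. Qed.

Lemma ele_add a b c d : ele a b -> ele c d -> ele (eadd a c) (eadd b d).
Proof.
case: a b c d => [a|] [b|] [c|] [d|] //=; apply: leq_add.
Qed.

Lemma eaddA : associative eadd.
Proof. by move=> [a|] [b|] [c|] //; rewrite /eadd addnA. Qed.

Lemma ele_addl a b : ele b (eadd a b).
Proof. by case: a b => [a|] [b|] //=; rewrite leq_addl. Qed.

Lemma eleZ_trans a b p : ele a b -> eleZ b p -> eleZ a p.
Proof.
case: a b => [a|] [b|] //= ab; apply: le_trans; by rewrite lez_nat.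
Qed.

Section Distance.
Variable G : digraph.
Implicit Types (x y z : G) (s : seq G).

Definition walk (n : nat) x y : Prop :=
  exists p : seq G, [/\ path (@edge G) x p, last x p = y & size p = n].

Definition dist x y : option nat :=
  if pselect (exists n, `[< walk n x y >]) is left ex
  then Some (ex_minn ex) else None.

Lemma walk_dist n x y : walk n x y -> ele (dist x y) (Some n).
Proof.
move=> w; rewrite /dist; case: pselect => [ex|[]]; last first.
  by exists n; apply/asboolP.
by case: ex_minnP => m _ /= -> //; apply/asboolP.
Qed.

Lemma dist_walk n x y : dist x y = Some n -> walk n x y.
Proof.
rewrite /dist; case: pselect => // ex [<-].
by case: ex_minnP => m /asboolP.
Qed.

Lemma walk_cat m n x y z : walk m x y -> walk n y z -> walk (m + n) x z.
Proof.
move=> [p [pp lp sp]] [q [pq lq sq]]; exists (p ++ q).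
by rewrite cat_path last_cat size_cat lp pp pq sp sq.
Qed.

Lemma dist_triangle x y z : ele (dist x z) (eadd (dist x y) (dist y z)).
Proof.
case xy: (dist x y) => [m|]; case yz: (dist y z) => [n|]; try by case: (dist x z).
by apply: walk_dist; apply: walk_cat (dist_walk xy) (dist_walk yz).
Qed.

Definition reachable x y : bool := dist x y != None.

Lemma reachable_trans : transitive reachable.
Proof.
move=> y x z; rewrite /reachable; have := dist_triangle x y z.
by case: (dist x y) (dist y z) (dist x z) => [m|] [n|] [k|].
Qed.

(* the length of (x_0, ..., x_k), i.e. d(x_0,x_1) + ... + d(x_{k-1},x_k) *)
Definition len s : option nat :=
  if s is x :: s' then foldr eadd (Some 0%N) (pairmap dist x s')
  else Some 0%N.

Lemma len_cons x y s : len (x :: y :: s) = eadd (dist x y) (len (y :: s)).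
Proof. by []. Qed.

Definition is_rtuple (k : int) s : bool :=
  [&& s != [::], sorted (fun x y => (x != y) && reachable x y) s
    & (size s)%:Z == k + 1].

Record rtuple (k : int) := RTuple { rt_seq :> seq G; _ : is_rtuple k rt_seq }.

HB.instance Definition _ k := [isSub of rtuple k for @rt_seq k].
HB.instance Definition _ k := [Choice of rtuple k by <:].

End Distance.

Definition del (T : Type) (m : nat) (s : seq T) := take m s ++ drop m.+1 s.

Lemma size_del (T : Type) m (s : seq T) :
  (m < size s)%N -> size (del m s) = (size s).-1.
Proof. by move=> ms; rewrite size_cat size_take size_drop ms; lia. Qed.

Lemma nth_del (T : Type) (x0 : T) m (s : seq T) i : (m < size s)%N ->
  nth x0 (del m s) i = nth x0 s (bump m i).
Proof.
move=> ms; rewrite nth_cat size_take ms /bump; case: ltnP => im.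
  by rewrite nth_take // add0n.
by rewrite nth_drop; congr nth; lia.
Qed.

Lemma del_del (T : Type) (s : seq T) i j : (j < i)%N -> (i < size s)%N ->
  del j (del i s) = del i.-1 (del j s).
Proof.
case: s => [//|x0 s'] ji; set s := x0 :: s' => si.
have sj : (j < size s)%N by lia.
have si' : (j < size (del i s))%N by rewrite size_del //; lia.
have sj' : (i.-1 < size (del j s))%N by rewrite size_del //; lia.
apply: (@eq_from_nth _ x0); first by
  rewrite (size_del si') (size_del sj') (size_del si) (size_del sj).
move=> k _; rewrite (nth_del _ _ si') (nth_del _ _ sj').
rewrite (nth_del _ _ si) (nth_del _ _ sj); congr nth.
by rewrite /bump; lia.
Qed.

Lemma map_del (S T : Type) (f : S -> T) m s : map f (del m s) = del m (map f s).
Proof. by rewrite /del map_cat map_take map_drop. Qed.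

Lemma del_subseq (T : eqType) m (s : seq T) : subseq (del m s) s.
Proof.
rewrite -{2}(cat_take_drop m s); apply: cat_subseq => //.
by rewrite -add1n -drop_drop drop_subseq.
Qed.

Lemma len_del (G : digraph) m (s : seq G) : ele (len (del m s)) (len s).
Proof.
elim: s m => [|x [|y t] IH] m; first by case: m.
  by case: m => [|[|m]].
case: m => [|[|m]].
- by rewrite /del /=; apply: (ele_addl (dist x y) (len (y :: t))).
- have -> : del 1 [:: x, y & t] = x :: t by rewrite /del; case: t {IH}.
  case: t {IH} => [|z t]; first by rewrite len_cons; case: (dist x y).
  by rewrite !len_cons eaddA ele_add ?dist_triangle ?ele_refl.
- rewrite -[del _ _]/(x :: y :: del m t) !len_cons; apply: ele_add.
    exact: ele_refl.
  exact: (IH m.+1).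
Qed.

Section DHomLemmas.
Variables (G H : digraph) (f : dhom G H).

Lemma dhom_walk n x y : walk n x y -> ele (dist (f x) (f y)) (Some n).
Proof.
suff W : walk n x y -> exists2 m, (m <= n)%N & walk m (f x) (f y).
  by move=> /W[m mn /walk_dist]/ele_trans; apply.
move=> [p [+ + <-]]; elim: p x => [|z p IH] x /=.
  by move=> _ <-; exists 0%N => //; exists [::].
move=> /andP[xz zp] /(IH _ zp)[m mp [q [pq lq sq]]].
have /orP[/eqP e|e] := dhomP f xz.
  by exists m; [lia | exists q; rewrite e].
by exists m.+1 => //; exists (f z :: q); rewrite /= e pq lq sq.
Qed.

Lemma dhom_dist x y : ele (dist (f x) (f y)) (dist x y).
Proof.
case xy: (dist x y) => [n|]; last by case: (dist _ _).
exact: dhom_walk (dist_walk xy).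
Qed.

Lemma dhom_reachable x y : reachable x y -> reachable (f x) (f y).
Proof.
rewrite /reachable; have := dhom_dist x y.
by case: (dist x y) (dist (f x) (f y)) => [m|] [n|].
Qed.

Lemma dhom_len s : ele (len (map f s)) (len s).
Proof.
elim: s => [|x [|y t] IH] //; rewrite len_cons map_cons.
rewrite [X in ele X _](_ : _ = eadd (dist (f x) (f y)) (len (map f (y :: t)))) //.
by rewrite ele_add ?dhom_dist.
Qed.

Lemma dhom_sorted s : sorted (@reachable G) s -> sorted (@reachable H) (map f s).
Proof. exact: homo_sorted dhom_reachable _. Qed.

End DHomLemmas.

Lemma alternating_cancel (R : pzRingType) (V : lmodType R) (n : nat)
    (F : nat -> nat -> V) :
  (forall i j, (j < i)%N -> (i < n.+1)%N -> F i j = F j i.-1) ->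
  \sum_(i < n.+1) \sum_(j < n) (-1) ^+ i *: ((-1) ^+ j *: F i j) = 0.
Proof.
move=> FE.
pose A : V :=
  \sum_(i < n) \sum_(j < n | (i <= j)%N) (-1) ^+ i *: ((-1) ^+ j *: F i j).
have -> : \sum_(i < n.+1) \sum_(j < n) (-1) ^+ i *: ((-1) ^+ j *: F i j)
   = \sum_(i < n.+1) \sum_(j < n | (i <= j)%N) (-1) ^+ i *: ((-1) ^+ j *: F i j)
   + \sum_(i < n.+1) \sum_(j < n | (j < i)%N) (-1) ^+ i *: ((-1) ^+ j *: F i j).
  rewrite -big_split; apply: eq_bigr => i _ /=.
  rewrite (bigID (fun j : 'I_n => (i <= j)%N)) /=; congr (_ + _).
  by apply: eq_bigl => j; rewrite -ltnNge.
have -> : \sum_(i < n.+1) \sum_(j < n | (i <= j)%N)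
            (-1) ^+ i *: ((-1) ^+ j *: F i j) = A.
  rewrite big_ord_recr /= [X in _ + X]big1 ?addr0 // => j.
  by rewrite leqNgt ltn_ord.
have -> : \sum_(i < n.+1) \sum_(j < n | (j < i)%N)
            (-1) ^+ i *: ((-1) ^+ j *: F i j) = - A.
  rewrite big_ord_recl /= big1 ?add0r //.
  transitivity (\sum_(i < n) \sum_(j < n | (j <= i)%N)
      - ((-1) ^+ j *: ((-1) ^+ i *: F j i))).
    apply: eq_bigr => i _; apply: eq_bigr => j ji.
    rewrite /bump add1n FE ?ltnS //= exprS mulN1r scaleNr.
    by rewrite !scalerA -!exprD addnC.
  rewrite (exchange_big_dep xpredT) //= /A -sumrN; apply: eq_bigr => i _.
  by rewrite -sumrN.
by rewrite subrr.
Qed.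

Section ReachabilityComplex.
Variables (R : pzRingType) (G : digraph).
Implicit Types s : seq G.

Definition RCmod (k : int) : lmodType R := freemod R (rtuple G k).

(* The generator s of RC_k, or 0 if s is not an admissible (k+1)-tuple. A
   nonempty face of an admissible tuple is inadmissible exactly when it has
   equal consecutive entries, since reachability is transitive. *)
Definition bas k s : RCmod k :=
  if insub s is Some t then gen (t : rtuple G k) else 0.

Definition RC_d k l : {linear RCmod k -> RCmod l} :=
  free_lift (fun t : rtuple G k =>
    \sum_(m < size t) (-1) ^+ m *: bas l (del m t)).

Lemma bas_rtuple k (t : rtuple G k) : bas k t = gen t.
Proof.
rewrite /bas; case: insubP => [u _ e|]; last by rewrite (valP t).
by congr gen; apply: val_inj.
Qed.

Lemma bas_out k s : ~~ is_rtuple k s -> bas k s = 0.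
Proof. by move=> h; rewrite /bas insubN. Qed.

Lemma bas_degen k s1 x s2 : bas k (s1 ++ [:: x, x & s2]) = 0.
Proof.
apply: bas_out; apply/negP => /and3P[_ + _].
case: s1 => [|y s1] /=; first by rewrite eqxx.
by rewrite cat_path /= eqxx /= !andbF.
Qed.

Lemma degenP s : sorted (@reachable G) s ->
  ~~ sorted (fun x y => (x != y) && reachable x y) s ->
  exists s1 x s2, s = s1 ++ [:: x, x & s2].
Proof.
elim: s => [//|x [//|y s] IH] /= /andP[xy sy].
rewrite xy andbT negb_and negbK => /orP[/eqP <-|]; first by exists [::], x, s.
by move/(IH sy) => [s1 [z [s2 ->]]]; exists (x :: s1), z, s2.
Qed.

Lemma RC_d_bas k l s : sorted (@reachable G) s -> (size s)%:Z = k + 1 ->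
  RC_d k l (bas k s) = \sum_(m < size s) (-1) ^+ m *: bas l (del m s).
Proof.
move=> rs sk; case: (boolP (is_rtuple k s)) => [ks|nks].
  by rewrite -[s]/(rt_seq (RTuple ks)) bas_rtuple free_lift_gen.
rewrite bas_out // linear0; case: (eqVneq s [::]) => [->|s0].
  by rewrite big_ord0.
have [||s1 [x [s2 ->]]] := @degenP s; rewrite //.
  by move: nks; rewrite /is_rtuple s0 sk eqxx andbT.
rewrite -(big_mkord xpredT
  (fun m => (-1) ^+ m *: bas l (del m (s1 ++ [:: x, x & s2])))).
rewrite size_cat /= (@big_cat_nat _ _ _ (size s1)) ?leq_addr //=.
rewrite big_nat big1 ?add0r => [|m /andP[_ m1]]; last first.
  rewrite /del take_cat m1 drop_cat; case: ltnP => m1'.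
    by rewrite catA bas_degen scaler0.
  have -> : m.+1 = size s1 by lia.
  by rewrite subnn drop0 bas_degen scaler0.
rewrite big_ltn; last by lia.
rewrite big_ltn; last by lia.
rewrite big_nat big1 ?addr0 => [|m /andP[m1 m2]]; last first.
  rewrite /del take_cat ltnNge (_ : (size s1 <= m)%N) /=; last by lia.
  have -> : (m - size s1 = (m - (size s1).+2).+2)%N by lia.
  by rewrite /= -catA /= bas_degen scaler0.
have -> : del (size s1) (s1 ++ [:: x, x & s2]) = s1 ++ x :: s2.
  rewrite /del take_size_cat // drop_cat ltnNge leqnSn /=.
  by rewrite subSn // subnn.
have -> : del (size s1).+1 (s1 ++ [:: x, x & s2]) = s1 ++ x :: s2.
  rewrite /del take_cat drop_cat !ltnNge leqnSn ltnW //=.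
  by rewrite !subSn // subnn /= drop0 -catA.
by rewrite exprS mulN1r scaleNr addrN.
Qed.

Lemma RC_shape k l : k != l + 1 -> forall x, RC_d k l x = 0.
Proof.
move=> kl x; rewrite -[RHS]/((\0 : RCmod k -> RCmod l) x).
apply: freemod_ext => t; rewrite free_lift_gen big1 // => m _.
rewrite bas_out ?scaler0 //; apply: contra kl => /and3P[_ _ /eqP].
have /and3P[_ _ /eqP st] := valP t; have mt := ltn_ord m.
rewrite (size_del mt) => sd; apply/eqP; move: st sd mt.
by rewrite /=; lia.
Qed.

Lemma rtuple_sorted k (t : rtuple G k) : sorted (@reachable G) t.
Proof.
have /and3P[_ + _] := valP t; apply: sub_sorted => x y.
by case/andP.
Qed.

Lemma rtuple_size k (t : rtuple G k) : (size t)%:Z = k + 1.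
Proof. by have /and3P[_ _ /eqP] := valP t. Qed.

Lemma RC_dd k l m x : RC_d l m (RC_d k l x) = 0.
Proof.
case: (eqVneq k (l + 1)) => [kl|kl]; last by rewrite (RC_shape kl) linear0.
rewrite -[RHS]/((\0 : RCmod l -> RCmod m) (RC_d k l x)).
apply: freemod_ext2 => t; rewrite [RC_d k l (gen t)]free_lift_gen /=.
rewrite [LHS](linear_sum (RC_d l m)).
transitivity (\sum_(i < size t) \sum_(j < (size t).-1)
   (-1) ^+ i *: ((-1) ^+ j *: bas m (del j (del i t)))).
  apply: eq_bigr => i _; rewrite [LHS]linearZ -scaler_sumr; congr (_ *: _).
  rewrite RC_d_bas ?size_del //; last by have := rtuple_size t; have := ltn_ord i; lia.
  exact: subseq_sorted (@reachable_trans G) _ _ (del_subseq _ _) (rtuple_sorted t).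
have := ltn_ord; case st: (size t) => [|n] _; first by rewrite big_ord0.
apply: (@alternating_cancel _ _ n (fun i j => bas m (del j (del i t)))).
by move=> i j ji it; rewrite del_del ?st.
Qed.

Definition RC_Fpred (p k : int) : {pred RCmod k} :=
  fun x => all (fun t : rtuple G k => eleZ (len t) p) (msupp (x : freemod _ _)).
Arguments RC_Fpred : clear implicits.

Lemma RC_Fsubproof p k : GRing.subsemimod_closed (RC_Fpred p k).
Proof.
split; first split.
- by apply/allP => t; rewrite msupp0.
- move=> x y /allP xF /allP yF; apply/allP => t.
  by move/(fsubsetP (msuppD_le _ _)); rewrite in_fsetU => /orP[/xF|/yF].
- move=> a x /allP xF; apply/allP => t; rewrite -mcoeff_neq0 freemodZE => ax.
  apply: xF; rewrite -mcoeff_neq0; apply: contra ax => /eqP ->.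
  by rewrite mulr0.
Qed.
HB.instance Definition _ p k :=
  GRing.isSubmodClosed.Build R (RCmod k) (RC_Fpred p k) (RC_Fsubproof p k).
Definition RC_F p k : submodClosed (RCmod k) := RC_Fpred p k.

Lemma RC_F_bas p k s : eleZ (len s) p -> bas k s \in RC_F p k.
Proof.
move=> sp; rewrite /bas; case: insubP => [t _ ts|_]; last exact: rpred0.
apply/allP => u /(fsubsetP msuppU_le); rewrite in_fset1 => /eqP ->.
by rewrite -[rt_seq t]/(val t) ts.
Qed.

Lemma RC_Fmono p q k x : p <= q -> x \in RC_F p k -> x \in RC_F q k.
Proof.
move=> pq /allP xF; apply/allP => t /xF.
by rewrite /eleZ; case: (len t) => // n /le_trans; apply.
Qed.

Lemma RC_F_lift p k (M : lmodType R) (S : submodClosed M)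
    (h : rtuple G k -> M) (x : RCmod k) :
  (forall t : rtuple G k, eleZ (len t) p -> h t \in S) ->
  x \in RC_F p k -> free_lift h x \in S.
Proof.
move=> hS /allP xF; rewrite /= /free_lift_fun big_seq; apply: rpred_sum => t tx.
by apply: rpredZ; apply: hS; apply: xF.
Qed.

Lemma RC_Fd p k l x : x \in RC_F p k -> RC_d k l x \in RC_F p l.
Proof.
apply: RC_F_lift => t tp; apply: rpred_sum => m _; apply: rpredZ.
exact: RC_F_bas (eleZ_trans (len_del _ _) tp).
Qed.

Definition RC : fcomplex R := FComplex RC_shape RC_dd RC_Fmono RC_Fd.

End ReachabilityComplex.

Section ReachabilityMap.
Variables (R : pzRingType) (G H : digraph) (f : dhom G H).

(* (x_0, ..., x_k) |-> (f x_0, ..., f x_k), or 0 if consecutive entries of the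
   image coincide *)
Definition RCmap_fun k : {linear RCmod R G k -> RCmod R H k} :=
  free_lift (fun t : rtuple G k => bas R k (map f t)).

Lemma RCmap_bas k s : sorted (@reachable G) s ->
  RCmap_fun k (bas R k s) = bas R k (map f s).
Proof.
move=> rs; case: (boolP (is_rtuple k s)) => [ks|nks].
  by rewrite -[s]/(rt_seq (RTuple ks)) bas_rtuple free_lift_gen.
rewrite (bas_out _ nks) linear0; apply/esym.
case: (eqVneq s [::]) => [->|s0]; first exact: bas_out.
case: (eqVneq (size s)%:Z (k + 1)) => [sk|sk]; last first.
  by apply: bas_out; rewrite /is_rtuple size_map (negbTE sk) !andbF.
have [||s1 [x [s2 ->]]] := @degenP _ s; rewrite //.
  by move: nks; rewrite /is_rtuple s0 sk eqxx andbT.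
by rewrite map_cat /= bas_degen.
Qed.

Lemma RCmap_d k l x : RCmap_fun l (RC_d R G k l x) = RC_d R H k l (RCmap_fun k x).
Proof.
apply: freemod_ext2 => t.
rewrite [RC_d R G k l (gen t)]free_lift_gen [RCmap_fun k (gen t)]free_lift_gen.
rewrite [RHS]RC_d_bas ?size_map ?rtuple_size //; last first.
  exact/dhom_sorted/rtuple_sorted.
rewrite [LHS](linear_sum (RCmap_fun l)); apply: eq_bigr => i _.
rewrite [LHS]linearZ /=; congr (_ *: _).
rewrite [LHS]RCmap_bas ?map_del //.
exact: subseq_sorted (@reachable_trans G) _ _ (del_subseq _ _) (rtuple_sorted t).
Qed.

Lemma RCmap_F p k x : x \in RC_F R G p k -> RCmap_fun k x \in RC_F R H p k.
Proof.
apply: RC_F_lift => t tp; apply: RC_F_bas.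
exact: eleZ_trans (dhom_len _ _) tp.
Qed.

Definition RCmap : fcmap (RC R G) (RC R H) :=
  @FCMap R (RC R G) (RC R H) _ RCmap_d RCmap_F.

(* For a subgraph inclusion A -> X this is RC(X,A) = RC(X) / RC(A). *)
Definition RCrel : fcomplex R := coker RCmap.

End ReachabilityMap.

Section RelativeMap.
Variables (R : pzRingType) (A X Y P : digraph).
Variables (i : dhom A X) (f : dhom A Y) (g : dhom X P) (j : dhom Y P).
Hypothesis sq : forall a, g (i a) = j (f a).

Lemma RCmap_square n (x : RC R A n) :
  RCmap R g n (RCmap R i n x) = RCmap R j n (RCmap R f n x).
Proof.
move: x; apply: freemod_ext2 => t.
rewrite [RCmap R i n (gen t)]free_lift_gen [RCmap R f n (gen t)]free_lift_gen.
rewrite [LHS]RCmap_bas ?[RHS]RCmap_bas.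
- by congr bas; rewrite -!map_comp; apply: eq_map.
- exact/dhom_sorted/rtuple_sorted.
- exact/dhom_sorted/rtuple_sorted.
Qed.

Definition RCrel_map : fcmap (RCrel R i) (RCrel R j) := coker_map RCmap_square.

End RelativeMap.

Section MagnitudePath.
Variables (R : pzRingType) (A X : digraph) (i : dhom A X).

Definition MPSS (r : nat) (p q : int) : lmodType R := Epage (RCrel R i) r p q.
Definition MH (k l : int) : lmodType R := MPSS 1 l (k - l).
Definition PH (k l : int) : lmodType R := MPSS 2 l (k - l).

End MagnitudePath.

Section MagnitudePathMap.
Variables (R : pzRingType) (A X Y P : digraph).
Variables (i : dhom A X) (f : dhom A Y) (g : dhom X P) (j : dhom Y P).
Hypothesis sq : forall a, g (i a) = j (f a).

Definition MPSS_map (r : nat) (p q : int) :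
    {linear MPSS R i r p q -> MPSS R j r p q} :=
  Epage_map (RCrel_map R sq) r p q.
Definition MH_map (k l : int) : {linear MH R i k l -> MH R j k l} :=
  MPSS_map 1 l (k - l).
Definition PH_map (k l : int) : {linear PH R i k l -> PH R j k l} :=
  MPSS_map 2 l (k - l).

End MagnitudePathMap.

Arguments MPSS_map R {A X Y P i f g j} sq r p q.
Arguments MH_map R {A X Y P i f g j} sq k l.
Arguments PH_map R {A X Y P i f g j} sq k l.

(* The first two fields say that i is (up to renaming the vertices of A) the
   inclusion of an induced subgraph. *)
Record is_cofibration (A X : digraph) (i : dhom A X) : Prop := IsCofibration {
  cofib_inj : injective i;
  cofib_induced : forall a b, edge (i a) (i b) = edge a b;
  cofib_no_edge : forall x a, ~ (exists b, x = i b) -> ~~ edge x (i a);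
  cofib_proj : forall x, (exists a, reachable (i a) x) ->
    exists b, forall a, dist (i a) x = eadd (dist (i a) (i b)) (dist (i b) x)
}.

Record is_pushout (A X Y P : digraph) (i : dhom A X) (f : dhom A Y)
    (g : dhom X P) (j : dhom Y P) : Prop := IsPushout {
  pushout_sq : forall a, g (i a) = j (f a);
  pushout_univ : forall (Q : digraph) (u : dhom X Q) (v : dhom Y Q),
    (forall a, u (i a) = v (f a)) ->
    exists w : dhom P Q,
      [/\ forall x, w (g x) = u x, forall y, w (j y) = v y
        & forall w' : dhom P Q, (forall x, w' (g x) = u x) ->
            (forall y, w' (j y) = v y) -> forall z, w' z = w z]
}.

(* Main.v *)
From HB Require Import structures.
Require Import Defs.
From mathcomp Require Import all_boot all_order all_algebra.
From mathcomp Require Import boolp.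
From mathcomp Require Import finmap monalg.
From mathcomp Require Import zify.

Set Implicit Arguments.
Unset Strict Implicit.
Unset Printing Implicit Defensive.

Import Order.TTheory GRing.Theory Num.Theory.

Local Open Scope ring_scope.
Local Open Scope quotient_scope.

(* An edge never enters A from outside, so an admissible tuple of X is a word
   ys ++ xs with ys in A and xs outside A, and RC(X) has an increasing
   filtration by the number of entries outside A; its bottom layer is RC(A).
   Write pi for the projection of the cofibration and x1 for the head of xs.
   Since d(a, x1) = d(a, pi x1) + d(pi x1, x1), the operator
     S (ys ++ xs) = (-1)^|ys| (ys ++ pi x1 :: xs)   (0 if ys or xs is empty)
   preserves length. Modulo fewer entries outside A, d S + S d = id - E, where
   E kills the tuples with |ys| >= 2, replaces ys by pi x1 when |ys| = 1 and
   fixes those with ys empty. The pushout P has the same structure relative to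
   Y, with projection g pi: the vertices of P outside Y are those of X outside
   A, with the same distances. The tuples in the image of E are therefore the
   same for X and P, so E factors as RC(P) -> RC(X) -> RC(P), and the first
   factor h (hinv below) is a chain map modulo fewer outside entries and a
   filtered inverse of RC(g) up to S. Induction on the number of outside entries
   then shows that every quotient F_a / F_b of the cone of
   RC(X,A) -> RC(P,Y) is acyclic, which gives the isomorphism of all pages
   E^r, r >= 1. *)

Lemma inj_surj_bij (T U : Type) (h : T -> U) :
  injective h -> (forall y, exists x, h x = y) -> bijective h.
Proof.
move=> h_inj /choice[h' hK]; exists h' => // x.
by apply: h_inj; rewrite hK.
Qed.

Section SubmodOpp.
Variables (R : pzRingType) (V : lmodType R) (S : submodClosed V).

Lemma submodN x : (- x \in S) = (x \in S).
Proof. by apply/idP/idP => /(rpredZ (-1)); rewrite scaleN1r ?opprK. Qed.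

Lemma submodB x y : x \in S -> y \in S -> x - y \in S.
Proof. by move=> xS yS; rewrite rpredD ?submodN. Qed.

End SubmodOpp.

(** * Pages of a filtered map with acyclic cone *)

Section FilteredCone.
Variables (R : pzRingType) (C D : fcomplex R) (u : fcmap C D).

(* The subquotient F_a / F_b of the mapping cone of u has no homology, written
   out on representatives. *)
Definition cone_acyclic (a b : int) : Prop :=
  forall n0 n1 n2 : int, n1 = n0 + 1 -> n2 = n1 + 1 ->
  forall (x : C n0) (y : D n1),
    x \in fc_F C a n0 -> y \in fc_F D a n1 ->
    (forall m, fc_d C n0 m x \in fc_F C b m) ->
    fc_d D n1 n0 y - u n0 x \in fc_F D b n0 ->
  exists (v : C n1) (w : D n2),
    [/\ v \in fc_F C a n1, w \in fc_F D a n2,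
        x - fc_d C n1 n0 v \in fc_F C b n0
      & y - fc_d D n2 n1 w - u n1 v \in fc_F D b n1].

Hypothesis uK : forall a b, b <= a -> cone_acyclic a b.

Variables (r : nat) (p q : int).
Hypothesis r_gt0 : (1 <= r)%N.

(** Acyclicity of F_p / F_{p-r} of the cone, applied to the cycle (0, y), gives v and w. As r >= 1,
    the error y - dw - uv, which is in F_{p-r}, lies in Z^{r-1}_{p-1}, and w lies in
    Z^{r-1}_{p+r-1}; so v represents a preimage. *)
Lemma Epage_map_surj (z : Epage D r p q) : exists x, Epage_map u r p q x = z.
Proof.
elim/quotW: z => -[y /= yZ]; have /andP[yF /asboolP dyF] := yZ.
have pr : p - r%:Z <= p by lia.
have n1E : p + q = p + q - 1 + 1 by lia.
have [||v [w [vF wF vE wE]]] :=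
  uK pr n1E (erefl (p + q + 1)) (rpred0 (fc_F C p _)) yF.
- by move=> m; rewrite linear0 rpred0.
- by rewrite linear0 subr0; apply: dyF.
have vZ : v \in Zpage C r%:Z p (p + q).
  apply/andP; split=> //; apply/asboolP => m.
  have [->|nm] := eqVneq m (p + q - 1); first by move: vE; rewrite sub0r submodN.
  by rewrite fc_shape ?rpred0 //; apply: contra nm => /eqP; lia.
exists (\pi_(lquot _) (Subm vZ)).
rewrite [LHS](lquot_mapE (@Epage_map_subproof _ _ _ u _ _ _)).
apply/lquotP/asboolP.
exists (- (y - fc_d D _ _ w - u _ v)), (- w); split.
- rewrite submodN; apply/andP; split; first by apply: fc_Fmono wE; lia.
  apply/asboolP => m; have -> : p - 1 - (r%:Z - 1) = p - r%:Z by lia.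
  exact: fc_Fd.
- rewrite submodN; apply/andP; split; first by apply: fc_Fmono wF; lia.
  apply/asboolP => m; have -> : p + r%:Z - 1 - (r%:Z - 1) = p by lia.
  exact: fc_Fd.
- by rewrite linearN /= !opprB -addrA [in RHS]addrAC subrr sub0r.
Qed.

(** If ux = y + dw vanishes on the page, then (x, w) is a cycle of the cone in F_{p+r-1} modulo
    F_{p-1}. Acyclicity gives v with x - dv in F_{p-1}, and x = (x - dv) + dv exhibits x as zero on
    the page. *)
Lemma Epage_map_inj : injective (Epage_map u r p q).
Proof.
move=> x1 x2 /eqP; rewrite -subr_eq0 -linearB => /eqP e; apply/eqP.
rewrite -subr_eq0; move: (x1 - x2) e => {x1 x2}; elim/quotW => -[x /= xZ].
have /andP[xF /asboolP dxF] := xZ.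
rewrite [LHS](lquot_mapE (@Epage_map_subproof _ _ _ u _ _ _)).
rewrite -(linear0 (lquot_pi _)) => /lquotP.
rewrite subr0 => /asboolP[y [w [yZ wZ /= e]]].
have /andP[yF /asboolP dyF] := yZ; have /andP[wF /asboolP dwF] := wZ.
have pr : p - 1 <= p + r%:Z - 1 by lia.
have /(_ x)[|m||v [_ [vF _ vE _]]] :=
  uK pr (erefl (p + q + 1)) (erefl _) _ wF.
- by apply: fc_Fmono xF; lia.
- by apply: fc_Fmono (dxF m); lia.
- by rewrite e opprD addrCA subrr addr0 submodN.
apply/eqP; rewrite -(linear0 (lquot_pi _)); apply/lquotP; rewrite subr0.
apply/asboolP; exists (x - fc_d C _ _ v), v; split=> /=; last by rewrite subrK.
- apply/andP; split=> //; apply/asboolP => m.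
  have -> : p - 1 - (r%:Z - 1) = p - r%:Z by lia.
  by rewrite linearB /= fc_dd subr0; apply: dxF.
- apply/andP; split=> //; apply/asboolP => m.
  have -> : p + r%:Z - 1 - (r%:Z - 1) = p by lia.
  (* Although v is only in F_{p+r-1}, dv = x - (x - dv) lies in F_p. *)
  have [->|nm] := eqVneq m (p + q).
    rewrite -[fc_d _ _ _ v](subKr x) submodB //.
    by apply: fc_Fmono vE; lia.
  by rewrite fc_shape ?rpred0 //; apply: contra nm => /eqP; lia.
Qed.

Lemma Epage_map_bij : bijective (Epage_map u r p q).
Proof. exact: inj_surj_bij Epage_map_inj Epage_map_surj. Qed.

End FilteredCone.

(** * Filtered homotopy of a projection *)

Section Span.
Variables (R : pzRingType) (K : choiceType).
Implicit Types (Q : pred K) (z : freemod R K).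

Definition gspan_pred Q : {pred freemod R K} :=
  fun z => all Q (msupp (z : freemod R K)).

Lemma gspan_subproof Q : GRing.subsemimod_closed (gspan_pred Q).
Proof.
split; first split.
- by apply/allP => t; rewrite msupp0.
- move=> x y /allP xQ /allP yQ; apply/allP => t.
  by move/(fsubsetP (msuppD_le _ _)); rewrite in_fsetU => /orP[/xQ|/yQ].
- move=> a x /allP xQ; apply/allP => t; rewrite -mcoeff_neq0 freemodZE => ax.
  apply: xQ; rewrite -mcoeff_neq0; apply: contra ax => /eqP ->.
  by rewrite mulr0.
Qed.
HB.instance Definition _ Q :=
  GRing.isSubmodClosed.Build R (freemod R K) (gspan_pred Q) (gspan_subproof Q).
Definition gspan Q : submodClosed (freemod R K) := gspan_pred Q.

Lemma gspan_gen Q k : Q k -> gen k \in gspan Q.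
Proof.
by move=> Qk; apply/allP => l /(fsubsetP msuppU_le); rewrite in_fset1 => /eqP ->.
Qed.

Lemma gspan_sub Q Q' z :
  (forall k, Q k -> Q' k) -> z \in gspan Q -> z \in gspan Q'.
Proof. by move=> QQ' /allP zQ; apply/allP => k /zQ; apply: QQ'. Qed.

Lemma gspan_linear Q (M : lmodType R) (S : submodClosed M)
    (h : {linear freemod R K -> M}) z :
  (forall k, Q k -> h (gen k) \in S) -> z \in gspan Q -> h z \in S.
Proof.
move=> hS /allP zQ; rewrite [z]freemodE linear_sum big_seq; apply: rpred_sum.
by move=> k kz; rewrite linearZ; apply: rpredZ; apply/hS/zQ.
Qed.

Lemma gspan_split Q1 Q2 z : z \in gspan (fun k => Q1 k || Q2 k) ->
  exists z1 z2, [/\ z1 \in gspan Q1, z2 \in gspan Q2 & z = z1 + z2].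
Proof.
move=> /allP zQ; rewrite [z]freemodE (bigID Q1) /=.
eexists _, _; split=> //.
- by apply: rpred_sum => k Qk; apply/rpredZ/gspan_gen.
- rewrite big_seq_cond; apply: rpred_sum => k /andP[kz nQk].
  by apply/rpredZ/gspan_gen; have := zQ k kz; rewrite (negbTE nQk).
Qed.

End Span.

(** * Alternating face sums of functions on words *)

Section Faces.
Variables (R : pzRingType) (T : Type) (V : lmodType R).
Implicit Types (phi psi : seq T -> V) (s : seq T).

(** [phi] absorbs the fixed part of a word and any linear map applied after the differential, so
    that the faces in the two halves of a word can be computed separately. *)
Definition faces phi s : V := \sum_(m < size s) (-1) ^+ m *: phi (del m s).

Lemma faces_nil phi : faces phi [::] = 0.
Proof. by rewrite /faces big_ord0. Qed.

Lemma faces0 s : faces (fun=> 0) s = 0.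
Proof. by apply: big1 => m _; rewrite scaler0. Qed.

Lemma faces_cat phi s1 s2 : faces phi (s1 ++ s2) =
  faces (fun s => phi (s ++ s2)) s1 +
  (-1) ^+ size s1 *: faces (fun s => phi (s1 ++ s)) s2.
Proof.
rewrite /faces size_cat big_split_ord /= scaler_sumr; congr (_ + _).
  apply: eq_bigr => m _; congr (_ *: phi _).
  have m1 := ltn_ord m; rewrite /del take_cat m1 drop_cat.
  case: ltnP => m1'; first by rewrite catA.
  have -> : m.+1 = size s1 by lia.
  by rewrite subnn drop0 drop_size cats0.
apply: eq_bigr => m _; rewrite scalerA -exprD; congr (_ *: phi _).
rewrite /del take_cat drop_cat !ltnNge leq_addr /= -addnS leq_addr /=.
by rewrite !addKn catA.
Qed.

Lemma faces_cons phi x s : faces phi (x :: s) =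
  phi s - faces (fun s => phi (x :: s)) s.
Proof.
rewrite -cat1s faces_cat {1}/faces big_ord_recl big_ord0 addr0 /=.
by rewrite /del /= ?take0 ?drop0 scale1r expr1 scaleN1r.
Qed.

Lemma faces_scale phi a s : faces (fun s => a *: phi s) s = a *: faces phi s.
Proof.
rewrite /faces scaler_sumr; apply: eq_bigr => m _.
by rewrite !scalerA (commrX m (commrN1 a)).
Qed.

End Faces.

Lemma faces_map (R : pzRingType) (S T : Type) (V : lmodType R) (h : S -> T)
    (phi : seq T -> V) s :
  faces phi (map h s) = faces (fun s => phi (map h s)) s.
Proof. by rewrite /faces size_map; apply: eq_bigr => m _; rewrite map_del. Qed.

(** Faces are described only as subsequences with one entry fewer: sortedness and lying inside or
    outside [B] pass to subsequences. *)
Lemma eq_faces (R : pzRingType) (G : digraph) (V : lmodType R)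
    (phi psi : seq G -> V) (s : seq G) :
  (forall s' : seq G, subseq s' s -> size s = (size s').+1 -> phi s' = psi s') ->
  faces phi s = faces psi s.
Proof.
move=> e; apply: eq_bigr => m _; congr (_ *: _).
apply: e; first exact: del_subseq.
by rewrite size_del // prednK //; apply: leq_trans (ltn_ord m).
Qed.

Lemma linear_RC_d (R : pzRingType) (G : digraph) (V : lmodType R) (k l : int)
    (h : {linear RCmod R G l -> V}) (s : seq G) :
  sorted (@reachable G) s -> (size s)%:Z = k + 1 ->
  h (RC_d R G k l (bas R k s)) = faces (fun s' => h (bas R l s')) s.
Proof.
move=> st sz; rewrite RC_d_bas // linear_sum.
by apply: eq_bigr => i _; rewrite [LHS]linearZ.
Qed.

Lemma filter_none (T : Type) (a : pred T) s :
  all (predC a) s -> filter a s = [::].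
Proof. by elim: s => //= x s IH /andP[/negbTE -> /IH]. Qed.

Lemma len_cat (G : digraph) (y z : G) ys zs : len ((y :: ys) ++ z :: zs) =
  eadd (len (y :: ys)) (eadd (dist (last y ys) z) (len (z :: zs))).
Proof.
elim: ys y => [|y' ys IH] y; last by rewrite [LHS]len_cons IH len_cons eaddA.
by rewrite /= -[foldr _ _ _]/(len (z :: zs)); case: (eadd _ _).
Qed.

(** What the homotopy uses of a cofibration, stated for a predicate so as to apply to A in X and to
    Y in P alike. [pi] is total but constrained only at vertices outside [B] reachable from [B]. The
    inequality amounts to an equality, by the triangle inequality. *)
Record reach_retract (G : digraph) (B : pred G) (pi : G -> G) : Prop :=
  ReachRetract {
    retract_out : forall x y, ~~ B x -> reachable x y -> ~~ B y;
    retract_in : forall b x, B b -> ~~ B x -> reachable b x -> B (pi x);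
    retract_dist : forall b x, B b -> ~~ B x -> reachable b x ->
      ele (eadd (dist b (pi x)) (dist (pi x) x)) (dist b x)
  }.

Section Retraction.
Variables (R : pzRingType) (G : digraph) (B : pred G) (pi : G -> G).
Hypothesis GB : reach_retract B pi.
Implicit Types (s ys xs : seq G).

Local Notation reach_sorted := (sorted (@reachable G)).

Lemma retract_reach b x : B b -> ~~ B x -> reachable b x ->
  reachable b (pi x) && reachable (pi x) x.
Proof.
move=> Bb Bx bx; have := retract_dist GB Bb Bx bx; move: bx; rewrite /reachable.
by case: (dist b x) (dist b (pi x)) (dist (pi x) x) => [m|] [n|] [k|].
Qed.

(** An entry outside [B] reaches every later one, and these stay outside by [retract_out]. *)
Lemma reach_sorted_split s : reach_sorted s ->
  s = filter B s ++ filter (predC B) s.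
Proof.
elim: s => [//|x s IH] /= xs; have s_sorted := path_sorted xs.
case: ifPn => Bx /=; first by rewrite {1}IH.
suff xout : all (predC B) s by rewrite filter_none // (all_filterP xout).
apply: sub_all (order_path_min (@reachable_trans G) xs) => y.
exact: (retract_out GB).
Qed.

Lemma filter_splitl ys xs : all B ys -> all (predC B) xs ->
  filter B (ys ++ xs) = ys.
Proof.
by move=> /all_filterP By Bx; rewrite filter_cat By filter_none ?cats0.
Qed.

Lemma filter_splitr ys xs : all B ys -> all (predC B) xs ->
  filter (predC B) (ys ++ xs) = xs.
Proof.
move=> By /all_filterP Bx; rewrite filter_cat Bx filter_none //.
by apply: sub_all By => y /= ->.
Qed.

Definition insert_pi l ys xs : RCmod R G l :=
  if (ys, xs) is (_ :: _, x :: _)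
  then (-1) ^+ size ys *: bas R l (ys ++ pi x :: xs) else 0.

(** The operator S. Both degrees are free, as for [fc_d]: unless l = k + 1, the inserted word has
    the wrong size and [bas] returns 0. *)
Definition homotopy k l : {linear RCmod R G k -> RCmod R G l} :=
  free_lift (fun t : rtuple G k =>
    insert_pi l (filter B t) (filter (predC B) t)).

(** Degenerate words are covered too: two equal neighbours lie on the same side of the junction of
    [ys] and [xs], so inserting [pi x] does not separate them. *)
Lemma homotopy_bas k l ys xs : all B ys -> all (predC B) xs ->
  reach_sorted (ys ++ xs) -> (size (ys ++ xs))%:Z = k + 1 ->
  homotopy k l (bas R k (ys ++ xs)) = insert_pi l ys xs.
Proof.
move=> By Bx st sz; case: (boolP (is_rtuple k (ys ++ xs))) => [kt|nkt].
  rewrite -[ys ++ xs]/(rt_seq (RTuple kt)) bas_rtuple free_lift_gen /=.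
  by rewrite filter_splitl ?filter_splitr.
rewrite bas_out // linear0.
case: ys xs => [|y ys] [|x xs] // in By Bx st sz nkt *.
have [||s1 [z [s2 e]]] := @degenP _ (y :: ys ++ x :: xs); rewrite //.
  by move: nkt; rewrite /is_rtuple sz eqxx andbT.
rewrite /insert_pi; suff [s3 [s4 ->]] :
    exists s3 s4, (y :: ys) ++ pi x :: x :: xs = s3 ++ z :: z :: s4.
  by rewrite bas_degen scaler0.
have By' := By; have Bx' := Bx.
have {e} : (y :: ys) ++ x :: xs = s1 ++ [:: z, z & s2] by [].
elim: {y ys} (y :: ys) s1 By {st sz nkt By'} => [|y ys IH] s1 /=.
  by move=> _ e; exists (pi x :: s1), s2; rewrite e.
move=> /andP[By Bys]; case: s1 => [|z1 s1] /=.
  case=> <-; case: ys Bys {IH} => [|y' ys] /= Bys.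
    (* The repeated pair cannot straddle the junction, since [y] is in [B] and [x] is not. *)
    by case=> xy; move: Bx; rewrite /= xy By.
  by case=> <- _; exists [::], (ys ++ pi x :: x :: xs).
case=> _ /(IH _ Bys)[s3 [s4 e]]; exists (y :: s3), s4.
by rewrite /= e.
Qed.

Definition outs s := count (predC B) s.

Definition few_out (c : nat) k : submodClosed (RCmod R G k) :=
  gspan R (fun t : rtuple G k => (outs t <= c)%N).

Lemma bas_few_out c k s : (outs s <= c)%N -> bas R k s \in few_out c k.
Proof.
move=> sc; rewrite /bas; case: insubP => [t _ ts|_]; last exact: rpred0.
by apply: gspan_gen; rewrite -[rt_seq t]/(val t) ts.
Qed.

(* With m = |ys|, this is E (ys ++ xs); it depends on ys only through m, which
   is what makes it transportable between X and P. *)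
Definition crit l (m : nat) xs : RCmod R G l :=
  match m, xs with
  | 0%N, _ => bas R l xs
  | 1%N, x :: _ => bas R l (pi x :: xs)
  | _, _ => 0
  end.

Lemma insert_pi_nil l ys : insert_pi l ys [::] = 0.
Proof. by case: ys. Qed.

Lemma crit_nil l m : crit l m [::] = 0.
Proof. by case: m => [|[]] //; rewrite /crit bas_out. Qed.

Lemma outs_cat_in ys s : all B ys -> outs (ys ++ s) = outs s.
Proof.
elim: ys => //= y ys IH /andP[By Bys].
by rewrite -(IH Bys) /outs /= By.
Qed.

Lemma pi_between y ys x xs : all B (y :: ys) -> ~~ B x ->
  reach_sorted ((y :: ys) ++ x :: xs) ->
  [/\ B (pi x), reachable (last y ys) (pi x) & reachable (pi x) x].
Proof.
move=> By Bx; rewrite /= cat_path => /andP[_ /= /andP[yx _]].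
have Bl := allP By _ (mem_last y ys).
have /andP[-> ->] := retract_reach Bl Bx yx.
by rewrite (retract_in GB Bl Bx yx).
Qed.

Lemma insert_sorted y ys x xs : all B (y :: ys) -> ~~ B x ->
  reach_sorted ((y :: ys) ++ x :: xs) ->
  reach_sorted ((y :: ys) ++ pi x :: x :: xs).
Proof.
move=> By Bx st; have [_ lp px] := pi_between By Bx st.
by move: st; rewrite /= !cat_path /= lp px => /and3P[-> _ ->].
Qed.

Lemma insert_pi_few_out l c ys xs : all B ys -> all (predC B) xs ->
  reach_sorted (ys ++ xs) -> (size xs <= c)%N ->
  insert_pi l ys xs \in few_out c l.
Proof.
case: ys xs => [|y ys] [|x xs] By Bx st xc; rewrite ?rpred0 //.
have /andP[Bx1 _] := Bx; have [Bpi _ _] := pi_between By Bx1 st.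
apply/rpredZ/bas_few_out; rewrite outs_cat_in // /outs /= Bpi add0n.
exact: leq_trans (count_size _ (x :: xs)) xc.
Qed.

Lemma subseq_reach_sorted s s' :
  subseq s' s -> reach_sorted s -> reach_sorted s'.
Proof. exact: subseq_sorted (@reachable_trans G) _ _. Qed.

Lemma all_subseq (a : pred G) s s' : subseq s' s -> all a s -> all a s'.
Proof. by move=> /mem_subseq ss /allP al; apply/allP => z /ss /al. Qed.

(** In [homotopy_identity], [b] is the word, [b'] the word with [pi x] in place of [x], [e] the
    critical term, [i] the signed insertion after [x] is deleted; [a] and [c] collect the faces in
    [ys] and in the tail of [xs]. *)
Fact homotopy_identity_cancel (V : zmodType) (a b b' c i e : V) :
  b - (- a + b - b' + c) - (a - e + (i - c)) - e = b' - i.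
Proof.
rewrite !opprD !opprK !addrA.
rewrite [LHS](ACl ((1 * 3) * (2 * 6) * (5 * 9) * (7 * 10) * 4 * 8))%AC /=.
by rewrite subrr subrr addNr subrr !add0r.
Qed.

(** If [xs] is empty, the word itself has no outside entry; if [ys] is empty, S kills the word and
    its faces while E fixes it. Otherwise all cancels except two terms that have lost [x], hence one
    outside entry. *)
Lemma homotopy_identity (l k m : int) ys xs : k = l + 1 -> m = k + 1 ->
  all B ys -> all (predC B) xs -> reach_sorted (ys ++ xs) ->
  (size (ys ++ xs))%:Z = k + 1 ->
  bas R k (ys ++ xs) - RC_d R G m k (insert_pi m ys xs)
  - homotopy l k (RC_d R G k l (bas R k (ys ++ xs))) - crit k (size ys) xs
  \in few_out (size xs).-1 k.
Proof.
move=> kl mk By Bx st sz; rewrite linear_RC_d //.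
case: xs => [|x xs] in Bx st sz *.
  rewrite insert_pi_nil crit_nil linear0 cats0 (@eq_faces _ _ _ _ (fun=> 0)).
    by rewrite faces0 !subr0 bas_few_out // -[ys]cats0 outs_cat_in.
  move=> s' ss' zs'; rewrite cats0 in st sz.
  rewrite -[s']cats0 homotopy_bas ?cats0 ?insert_pi_nil //.
  - exact: all_subseq ss' By.
  - exact: subseq_reach_sorted ss' st.
  - by move: sz; rewrite zs'; lia.
case: ys => [|y ys] in By st sz *.
  rewrite /= linear0 subr0 (@eq_faces _ _ _ _ (fun=> 0)).
    by rewrite faces0 subr0 subrr rpred0.
  move=> s' ss' zs'; rewrite -[s']cat0s homotopy_bas //.
  - exact: all_subseq ss' Bx.
  - exact: subseq_reach_sorted ss' st.
  - by move: sz; rewrite !cat0s zs'; lia.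
have /andP[Bx1 Bxs] := Bx; have [Bpi _ _] := pi_between By Bx1 st.
have ist := insert_sorted By Bx1 st.
set n := size (y :: ys).
have crit1 : crit k n (x :: xs) =
    if ys is [::] then bas R k (pi x :: x :: xs) else 0.
  by rewrite /n; case: (ys).
(* S commutes with deletions in [ys] up to sign, unless [ys] has a single entry: then S kills the
   face, and the critical term makes up for it. *)
have fall : faces (fun s' => homotopy l k (bas R l (s' ++ x :: xs))) (y :: ys)
   = (-1) ^+ n.-1 *: faces (fun s' => bas R k (s' ++ pi x :: x :: xs)) (y :: ys)
     - crit k n (x :: xs).
  rewrite crit1; case: ys => [|y' ys] in By st sz ist @n {crit1} *.
    rewrite !faces_cons !faces_nil !subr0 scale1r subrr.
    by rewrite homotopy_bas //; [case/andP: st|move: sz => /=; lia].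
  rewrite subr0 -faces_scale; apply: eq_faces => s' ss' zs'.
  have ss'' : subseq (s' ++ x :: xs) ((y :: y' :: ys) ++ x :: xs).
    exact: cat_subseq.
  rewrite homotopy_bas //.
  - case: s' zs' {ss' ss''} => [//|z s' /= [zs']].
    by rewrite /insert_pi /n /= zs'.
  - exact: all_subseq ss' By.
  - exact: subseq_reach_sorted ss'' st.
  - by move: sz; rewrite !size_cat zs'; lia.
(* Deleting [x] changes the head of the outside part, hence the projection inserted; this face is
   kept apart. The others still insert [pi x]. *)
have fxs : faces (fun s' => homotopy l k (bas R l ((y :: ys) ++ s'))) (x :: xs)
  = insert_pi k (y :: ys) xs
    - (-1) ^+ n *: faces (fun s' => bas R k ((y :: ys) ++ pi x :: x :: s')) xs.
  rewrite faces_cons homotopy_bas //; last 2 first.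
  - by apply: subseq_reach_sorted st; apply: cat_subseq (subseq_cons _ _).
  - by move: sz; rewrite !size_cat /=; lia.
  congr (_ - _); rewrite -faces_scale; apply: eq_faces => s' ss' zs'.
  have ss'' : subseq ((y :: ys) ++ x :: s') ((y :: ys) ++ x :: xs).
    by apply: cat_subseq; rewrite //= eqxx.
  rewrite homotopy_bas //.
  - by apply/andP; split; last exact: all_subseq ss' Bxs.
  - exact: subseq_reach_sorted ss'' st.
  - by move: sz; rewrite !size_cat /= zs'; lia.
(* Faces of the word with [pi x] inserted: those in [ys], then those deleting [pi x], deleting [x],
   and in the tail. Past [ys] the sign of S squares to 1. *)
have dE : RC_d R G m k (insert_pi m (y :: ys) (x :: xs)) =
    (-1) ^+ n *: faces (fun s' => bas R k (s' ++ pi x :: x :: xs)) (y :: ys)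
    + bas R k ((y :: ys) ++ x :: xs) - bas R k ((y :: ys) ++ pi x :: xs)
    + faces (fun s' => bas R k ((y :: ys) ++ pi x :: x :: s')) xs.
  rewrite /insert_pi linearZ_LR RC_d_bas //; last first.
    by move: sz; rewrite !size_cat /=; lia.
  rewrite -[\sum_(_ < _) _]/(faces (bas R k) ((y :: ys) ++ pi x :: x :: xs)).
  rewrite faces_cat -/n.
  rewrite [faces _ (pi x :: _)]faces_cons [faces _ (x :: xs)]faces_cons.
  by rewrite scalerDr scalerA -expr2 sqrr_sign scale1r opprB !addrA addrAC.
rewrite dE faces_cat fall fxs -/n.
set b := bas R k (_ ++ x :: xs); set b' := bas R k (_ ++ pi x :: xs).
set a := faces _ (y :: ys); set c := faces _ xs.
rewrite scalerBr scalerA -expr2 sqrr_sign scale1r [in (-1) ^+ n *: a]/n exprS.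
rewrite mulN1r scaleNr [n.-1]/(size ys) homotopy_identity_cancel.
apply: submodB.
- apply: bas_few_out; rewrite outs_cat_in // /outs /= Bpi add0n.
  exact: count_size.
- apply/rpredZ/insert_pi_few_out => //.
  by apply: subseq_reach_sorted st; apply: cat_subseq (subseq_cons _ _).
Qed.

End Retraction.

(** * Spans of tuples that are short or have few outside entries *)

Section ShortOrFew.
Variables (R : pzRingType) (G : digraph) (B : pred G).

(* For c = 0 this is the preimage in RC(G) of F_b of the relative complex. *)
Definition short_or_few (b : int) (c : nat) k : submodClosed (RCmod R G k) :=
  gspan R (fun t : rtuple G k => eleZ (len t) b || (outs B t <= c)%N).

Lemma short_or_few_mono b c c' k z : (c <= c')%N ->
  z \in short_or_few b c k -> z \in short_or_few b c' k.
Proof.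
move=> cc'; apply: gspan_sub => t /orP[->//|/leq_trans -> //].
by rewrite orbT.
Qed.

(** The starting value for the induction on outside entries. *)
Lemma all_few b k (z : RCmod R G k) :
  z \in short_or_few b (absz (k + 1)) k.
Proof.
apply/allP => t _; apply/orP; right; apply: leq_trans (count_size _ _) _.
by rewrite -(rtuple_size t).
Qed.

Lemma short_span b c k z : z \in RC_F R G b k -> z \in short_or_few b c k.
Proof. by apply: (@gspan_sub R _ (fun t : rtuple G k => _)) => t ->. Qed.

Lemma few_span b c k z : z \in few_out R B c k -> z \in short_or_few b c k.
Proof. by apply: gspan_sub => t ->; rewrite orbT. Qed.

(** Short generators are handled by the filtration, which leaves only those with few outside entries
    to check. The target span is spelled out because [H] and [B'] may differ from [G] and [B]. *)
Lemma short_or_few_linear b c c' k (H : digraph) (B' : pred H) l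
    (h : {linear RCmod R G k -> RCmod R H l}) z :
  (forall p z, z \in RC_F R G p k -> h z \in RC_F R H p l) ->
  (forall t : rtuple G k, (outs B t <= c)%N ->
     h (gen t) \in gspan R (fun t : rtuple H l => (outs B' t <= c')%N)) ->
  z \in short_or_few b c k ->
  h z \in gspan R (fun t : rtuple H l => eleZ (len t) b || (outs B' t <= c')%N).
Proof.
move=> hF hW; apply: gspan_linear => t /orP[tb|tc].
  apply: (@gspan_sub R _ (fun t : rtuple H l => eleZ (len t) b)) => [s ->//|].
  by apply: hF; rewrite -bas_rtuple; apply: RC_F_bas.
by apply: gspan_sub (hW t tc) => s ->; rewrite orbT.
Qed.

Lemma RC_d_few_out c k l (t : rtuple G k) : (outs B t <= c)%N ->
  RC_d R G k l (gen t) \in few_out R B c l.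
Proof.
move=> tc; rewrite free_lift_gen; apply: rpred_sum => m _.
apply/rpredZ/bas_few_out; apply: leq_trans tc.
by rewrite leq_count_subseq ?del_subseq.
Qed.

End ShortOrFew.

Section RetractSpan.
Variables (R : pzRingType) (G : digraph) (B : pred G) (pi : G -> G).
Hypothesis GB : reach_retract B pi.

Lemma rtuple_split k (t : rtuple G k) : exists ys xs,
  [/\ t = ys ++ xs :> seq G, all B ys, all (predC B) xs,
      sorted (@reachable G) (ys ++ xs) & (size (ys ++ xs))%:Z = k + 1].
Proof.
have e := reach_sorted_split GB (rtuple_sorted t).
exists (filter B t), (filter (predC B) t); split=> //.
- exact: filter_all.
- exact: filter_all.
- by rewrite -e; apply: rtuple_sorted.
- by rewrite -e; apply: rtuple_size.
Qed.

Lemma len_insert y ys x xs : all B (y :: ys) -> ~~ B x ->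
  sorted (@reachable G) ((y :: ys) ++ x :: xs) ->
  ele (len ((y :: ys) ++ pi x :: x :: xs)) (len ((y :: ys) ++ x :: xs)).
Proof.
move=> By Bx st; have yx : reachable (last y ys) x.
  by move: st; rewrite /= cat_path => /andP[_ /= /andP[]].
rewrite !len_cat len_cons; apply: ele_add; first exact: ele_refl.
rewrite eaddA; apply: ele_add; last exact: ele_refl.
exact: (retract_dist GB (allP By _ (mem_last y ys)) Bx yx).
Qed.

Lemma homotopy_F p k l z : z \in RC_F R G p k ->
  homotopy R B pi k l z \in RC_F R G p l.
Proof.
apply: RC_F_lift => t; have [ys [xs [-> By Bx st _]]] := rtuple_split t.
rewrite filter_splitl ?filter_splitr // => tp.
case: ys xs By Bx st tp => [|y ys] [|x xs] By Bx st tp; rewrite ?rpred0 //.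
apply/rpredZ/RC_F_bas; apply: eleZ_trans tp; apply: len_insert => //.
by case/andP: Bx.
Qed.

Lemma homotopy_short_or_few b c k l z : z \in short_or_few R B b c k ->
  homotopy R B pi k l z \in short_or_few R B b c l.
Proof.
apply: short_or_few_linear => [p z'|t]; first exact: homotopy_F.
have [ys [xs [e By Bx st _]]] := rtuple_split t.
rewrite free_lift_gen e filter_splitl ?filter_splitr // outs_cat_in // => xc.
apply: (insert_pi_few_out R GB) => //.
by rewrite /outs -size_filter (all_filterP Bx) in xc.
Qed.

(** [E] is known only on generators, so that the two composites of [RCmap_fun] with [hinv] can be
    substituted for it. *)
Lemma homotopy_retract l k m (E : {linear RCmod R G k -> RCmod R G k}) b c z :
  k = l + 1 -> m = k + 1 ->
  (forall t : rtuple G k,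
     E (gen t) = crit R pi k (count B t) (filter (predC B) t)) ->
  (forall p z, z \in RC_F R G p k -> E z \in RC_F R G p k) ->
  z \in short_or_few R B b c k ->
  z - RC_d R G m k (homotopy R B pi k m z)
    - homotopy R B pi l k (RC_d R G k l z) - E z
  \in short_or_few R B b c.-1 k.
Proof.
move=> kl mk EE EF.
pose op : {linear RCmod R G k -> RCmod R G k} :=
  ((idfun \- (RC_d R G m k \o homotopy R B pi k m))
    \- (homotopy R B pi l k \o RC_d R G k l)) \- E.
apply: (short_or_few_linear (h := op)) => [p z' zp|t].
  by do !apply: submodB => //=; [apply/RC_Fd/homotopy_F|apply/homotopy_F/RC_Fd
    |apply: EF].
have [ys [xs [e By Bx st sz]]] := rtuple_split t.
rewrite /op /= EE {1}[homotopy R B pi k m (gen t)]free_lift_gen -!bas_rtuple e.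
rewrite -[count B _]size_filter filter_splitl ?filter_splitr // => tc.
have := homotopy_identity R GB kl mk By Bx st sz; apply: gspan_sub => s.
move/leq_trans; apply; rewrite outs_cat_in // /outs -size_filter in tc.
by rewrite (all_filterP Bx) in tc; rewrite -!subn1 leq_sub2r.
Qed.

End RetractSpan.

(** * Comparison of two projections *)

(* rho is the inverse of g between the vertices outside BX and outside BP. *)
Record excisive (X P : digraph) (g : dhom X P) (BX : pred X) (piX : X -> X)
    (BP : pred P) (piP : P -> P) (rho : P -> option X) : Prop := Excisive {
  exc_X : reach_retract BX piX;
  exc_P : reach_retract BP piP;
  exc_in : forall x, BP (g x) = BX x;
  exc_rho_in : forall z, BP z -> rho z = None;
  exc_rho_g : forall x, ~~ BX x -> rho (g x) = Some x;
  exc_out : forall z, ~~ BP z -> exists2 x, ~~ BX x & z = g x;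
  exc_pi : forall x, ~~ BX x -> piP (g x) = g (piX x);
  exc_dist : forall x x', ~~ BX x -> ~~ BX x' ->
    ele (dist x x') (dist (g x) (g x'));
  exc_dist_pi : forall y x, BP y -> ~~ BX x -> reachable y (g x) ->
    ele (dist (piX x) x) (dist y (g x));
  exc_pi_in : forall y x, BP y -> ~~ BX x -> reachable y (g x) -> BX (piX x)
}.

Section Excision.
Variables (R : pzRingType) (X P : digraph) (g : dhom X P).
Variables (BX : pred X) (piX : X -> X) (BP : pred P) (piP : P -> P).
Variable rho : P -> option X.
Hypothesis exc : excisive g BX piX BP piP rho.

Let GX := exc_X exc.
Let GP := exc_P exc.

Lemma all_in_map s : all BP (map g s) = all BX s.
Proof. by rewrite all_map; apply: eq_all => x /=; rewrite (exc_in exc). Qed.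

Lemma all_out_map s : all (predC BP) (map g s) = all (predC BX) s.
Proof. by rewrite all_map; apply: eq_all => x /=; rewrite (exc_in exc). Qed.

Lemma outs_lift zs : all (predC BP) zs ->
  exists2 xs, all (predC BX) xs & zs = map g xs.
Proof.
elim: zs => [|z zs IH] /=; first by exists [::].
move=> /andP[/(exc_out exc)[x Bx ->] /IH[xs Bxs ->]].
by exists (x :: xs) => //=; rewrite Bx.
Qed.

Lemma pmap_rho_in ys s : all BP ys -> pmap rho (ys ++ s) = pmap rho s.
Proof. by elim: ys => //= y ys IH /andP[/(exc_rho_in exc) -> /IH]. Qed.

Lemma pmap_rho_out xs : all (predC BX) xs -> pmap rho (map g xs) = xs.
Proof.
by elim: xs => //= x xs IH /andP[/(exc_rho_g exc) -> /IH /= ->].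
Qed.

Lemma rho_split ys xs : all BP ys -> all (predC BX) xs ->
  (count BP (ys ++ map g xs) = size ys) * (pmap rho (ys ++ map g xs) = xs).
Proof.
move=> By Bx; rewrite pmap_rho_in // pmap_rho_out // -size_filter.
by rewrite filter_splitl ?all_out_map.
Qed.

Lemma reach_sorted_out xs : all (predC BX) xs ->
  sorted (@reachable P) (map g xs) -> sorted (@reachable X) xs.
Proof.
elim: xs => [//|x [//|x' xs] IH] /= /andP[Bx Bxs] /andP[xx' xs_sorted].
apply/andP; split; last exact: IH.
have /andP[Bx' _] := Bxs; move: xx'; rewrite /reachable.
by have := exc_dist exc Bx Bx'; case: (dist x x') => [?|]; case: (dist _ _).
Qed.

Lemma len_out xs : all (predC BX) xs -> ele (len xs) (len (map g xs)).
Proof.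
elim: xs => [//|x [//|x' xs] IH] /andP[Bx Bxs]; have /andP[Bx' _] := Bxs.
rewrite len_cons [map _ _]/= [X in ele _ X]len_cons.
by apply: ele_add; [apply: (exc_dist exc)|apply: IH].
Qed.

Lemma reach_pi y x : BP y -> ~~ BX x -> reachable y (g x) ->
  reachable (piX x) x.
Proof.
move=> By Bx yx; have := exc_dist_pi exc By Bx yx; move: yx; rewrite /reachable.
by case: (dist y _) => // n; case: (dist _ x).
Qed.

(** As [rho] is [None] on [BP] and inverts [g] outside, [pmap rho] drops the part of a tuple in [BP]
    and lifts the rest to X; [count BP] is the length of the dropped part. *)
Definition hinv k : {linear RCmod R P k -> RCmod R X k} :=
  free_lift (fun t : rtuple P k => crit R piX k (count BP t) (pmap rho t)).

Lemma last_reach y ys x xs :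
  sorted (@reachable P) ((y :: ys) ++ map g (x :: xs)) ->
  reachable (last y ys) (g x).
Proof. by rewrite /= cat_path => /andP[_ /= /andP[]]. Qed.

(** Allows [RCmap_bas] and [RC_d_bas] to be applied to the word in [crit]. For m = 1 the last entry
    of [ys] reaches [g x], whence [piX x] reaches [x]. *)
Lemma crit_sorted m ys xs : all BP ys -> all (predC BX) xs ->
  sorted (@reachable P) (ys ++ map g xs) ->
  (m <= size ys)%N ->
  match m, xs with
  | 0, _ => sorted (@reachable X) xs
  | 1, x :: _ => sorted (@reachable X) (piX x :: xs)
  | _, _ => true
  end.
Proof.
move=> By Bx st; have xs_sorted : sorted (@reachable X) xs.
  apply: reach_sorted_out => //; apply: subseq_reach_sorted st.
  exact: suffix_subseq.
case: m => [//|[|//]]; case: ys By st => [//|y ys] By st _.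
case: xs Bx st xs_sorted => [//|x xs] /andP[Bx _] /last_reach yx /= ->.
by rewrite (reach_pi (allP By _ (mem_last y ys)) Bx yx).
Qed.

Lemma degen_out xs s1 z s2 : all (predC BX) xs ->
  map g xs = s1 ++ [:: z, z & s2] ->
  exists s3 x s4, xs = s3 ++ [:: x, x & s4].
Proof.
move=> Bx e; have : all (predC BP) (map g xs) by rewrite all_out_map.
rewrite e all_cat => /andP[_ /andP[/(exc_out exc)[x nBx zx] _]].
exists (pmap rho s1), x, (pmap rho s2); rewrite -[LHS](pmap_rho_out Bx) e.
by rewrite pmap_cat /= zx (exc_rho_g exc).
Qed.

Lemma hinv_bas k ys xs : all BP ys -> all (predC BX) xs ->
  sorted (@reachable P) (ys ++ map g xs) ->
  (size (ys ++ map g xs))%:Z = k + 1 ->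
  hinv k (bas R k (ys ++ map g xs)) = crit R piX k (size ys) xs.
Proof.
move=> By Bx st sz; case: (boolP (is_rtuple k (ys ++ map g xs))) => [kt|nkt].
  rewrite -[ys ++ _]/(rt_seq (RTuple kt)) bas_rtuple free_lift_gen /=.
  by rewrite !rho_split.
rewrite bas_out // linear0; case: (eqVneq (ys ++ map g xs) [::]) => [|s0].
  by case: ys xs {By Bx st sz nkt} => [|//] [|//] _; rewrite /= bas_out.
have [||s1 [z [s2 e]]] := @degenP _ (ys ++ map g xs); rewrite //.
  by move: nkt; rewrite /is_rtuple s0 sz eqxx andbT.
case: ys By {st sz nkt s0} e => [|y [|y' ys]] By e //.
- by have [s3 [x [s4 ->]]] := degen_out Bx e; rewrite /= bas_degen.
- case: xs Bx e => [|x xs] Bx; first by case: s1 => [|? []].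
  case: s1 => [[<- zy]|_ s1 [_ /(degen_out Bx)[s3 [x' [s4 e']]]]].
    by move: Bx; rewrite /= -(exc_in exc) zy (allP By _ (mem_head _ _)).
  by rewrite /= e' -cat_cons bas_degen.
Qed.

(** Both orders insert the same vertex, because [piP (g x) = g (piX x)]. *)
Lemma RCmap_homotopy k l z : RCmap_fun R g l (homotopy R BX piX k l z) =
  homotopy R BP piP k l (RCmap_fun R g k z).
Proof.
apply: freemod_ext2 => t; have [ys [xs [e By Bx st sz]]] := rtuple_split GX t.
rewrite [homotopy _ _ _ k l (gen t)]free_lift_gen.
rewrite [RCmap_fun _ _ k (gen t)]free_lift_gen e filter_splitl ?filter_splitr //.
rewrite map_cat homotopy_bas ?all_in_map ?all_out_map //; last 2 first.
- by rewrite -map_cat; apply: dhom_sorted.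
- by rewrite -map_cat size_map.
case: ys xs {e sz} By Bx st => [|y ys] [|x xs] By Bx st; rewrite ?linear0 //.
have /andP[Bx1 _] := Bx; rewrite [LHS]linearZ_LR.
rewrite [X in _ *: X](RCmap_bas _ _ _ (insert_sorted GX By Bx1 st)).
by rewrite /insert_pi /= size_map (exc_pi exc) // map_cat.
Qed.

Lemma hinv_RCmap k (t : rtuple X k) : hinv k (RCmap_fun R g k (gen t)) =
  crit R piX k (count BX t) (filter (predC BX) t).
Proof.
have [ys [xs [e By Bx st sz]]] := rtuple_split GX t.
rewrite [RCmap_fun _ _ k (gen t)]free_lift_gen e map_cat hinv_bas //.
- by rewrite size_map -size_filter filter_splitl ?filter_splitr.
- by rewrite all_in_map.
- by rewrite -map_cat; apply: dhom_sorted.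
- by rewrite -map_cat size_map.
Qed.

Lemma rtuple_split_out k (t : rtuple P k) : exists ys xs,
  [/\ t = ys ++ map g xs :> seq P, all BP ys, all (predC BX) xs,
      sorted (@reachable P) (ys ++ map g xs)
    & (size (ys ++ map g xs))%:Z = k + 1].
Proof.
have [ys [zs [e By /outs_lift[xs Bx zsE] st sz]]] := rtuple_split GP t.
by exists ys, xs; rewrite -zsE.
Qed.

Lemma RCmap_hinv k (t : rtuple P k) : RCmap_fun R g k (hinv k (gen t)) =
  crit R piP k (count BP t) (filter (predC BP) t).
Proof.
have [ys [xs [e By Bx st sz]]] := rtuple_split_out t.
rewrite free_lift_gen e !rho_split // filter_splitr ?all_out_map //.
have := crit_sorted By Bx st (leqnn _).
case: (size ys) => [|[|n]] /=; last by rewrite linear0.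
  by move=> xs_sorted; rewrite [LHS]RCmap_bas.
case: xs Bx {e st sz} => [|x xs] /=; first by rewrite linear0.
move=> /andP[Bx _] xs_sorted; rewrite [LHS]RCmap_bas //=.
by rewrite (exc_pi exc).
Qed.

(** Distances between outside vertices are no larger in X than in P; for a one-entry prefix [y], the
    new first step from [piX x] to [x] is bounded by the distance from [y] to [g x]. *)
Lemma hinv_F p k z : z \in RC_F R P p k -> hinv k z \in RC_F R X p k.
Proof.
apply: RC_F_lift => t; have [ys [xs [-> By Bx st _]]] := rtuple_split_out t.
rewrite !rho_split // => tp; case: ys By st tp => [|y [|y' ys]] By st tp //=.
- by apply: RC_F_bas; apply: eleZ_trans tp; apply: len_out.
- case: xs Bx st tp => [|x xs] Bx st tp; first exact: rpred0.
  apply: RC_F_bas; apply: eleZ_trans tp.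
  rewrite len_cons [X in ele _ X]len_cons; apply: ele_add; last exact: len_out.
  apply: (exc_dist_pi exc); [|by case/andP: Bx|exact: last_reach st].
  by case/andP: By.
- exact: rpred0.
Qed.

Lemma crit1_few_out l c y xs : BP y -> all (predC BX) xs ->
  sorted (@reachable P) (y :: map g xs) -> (size xs <= c)%N ->
  crit R piX l 1 xs \in few_out R BX c l.
Proof.
case: xs => [|x xs] By Bx st xc; first exact: rpred0.
apply: bas_few_out; have /andP[Bx1 _] := Bx; have /andP[yx _] := st.
rewrite /outs /= (exc_pi_in exc By Bx1 yx) add0n.
exact: leq_trans (count_size _ (x :: xs)) xc.
Qed.

(** The two composites agree exactly unless [ys] has one entry. In that case deleting the first
    outside entry [x] leaves [piX x] in front on one side and the projection of the next entry on
    the other; both words have fewer outside entries. *)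
Lemma hinv_d (k l : int) (t : rtuple P k) : k = l + 1 ->
  RC_d R X k l (hinv k (gen t)) - hinv l (RC_d R P k l (gen t))
  \in few_out R BX (outs BP t).-1 l.
Proof.
move=> kl; have [ys [xs [e By Bx st sz]]] := rtuple_split_out t.
rewrite -!bas_rtuple e hinv_bas // linear_RC_d // outs_cat_in //.
have -> : outs BP (map g xs) = size xs.
  by rewrite /outs -size_filter (all_filterP _) ?all_out_map ?size_map.
(* Two prefix entries give two equal faces of opposite sign; with three or more, every face still
   has at least two and [crit] vanishes. *)
have fys : faces (fun s => hinv l (bas R l (s ++ map g xs))) ys =
    if ys is [:: _] then bas R l xs else 0.
  have -> : faces (fun s => hinv l (bas R l (s ++ map g xs))) ys =
      faces (fun s => crit R piX l (size s) xs) ys.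
    apply: eq_faces => s ss zs; rewrite hinv_bas //.
    - exact: all_subseq ss By.
    - by apply: subseq_reach_sorted st; apply: cat_subseq.
    - by move: sz; rewrite !size_cat zs; lia.
  case: ys {By st sz e} => [|y [|y' [|y'' ys]]].
  - exact: faces_nil.
  - by rewrite faces_cons faces_nil subr0.
  - by rewrite !faces_cons faces_nil subr0 subrr.
  - rewrite (@eq_faces _ _ _ _ (fun=> 0)) ?faces0 // => s _ zs.
    by case: s zs => [|? [|? ?]].
have fxs : faces (fun s => hinv l (bas R l (ys ++ s))) (map g xs) =
    faces (fun s => crit R piX l (size ys) s) xs.
  rewrite faces_map; apply: eq_faces => s ss zs; rewrite hinv_bas //.
  - exact: all_subseq ss Bx.
  - by apply: subseq_reach_sorted st; apply: cat_subseq => //; apply: map_subseq.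
  - by move: sz; rewrite !size_cat !size_map zs; lia.
rewrite faces_cat fys fxs.
have cst := crit_sorted By Bx st (leqnn _).
case: ys By {fys fxs e} st sz cst => [|y [|y' ys]] By st sz cst /=.
- rewrite RC_d_bas //; last by rewrite -sz size_map.
  by rewrite add0r scale1r subrr rpred0.
- case: xs Bx st sz cst => [|x xs] Bx st sz cst.
    by rewrite linear0 faces_nil scaler0 bas_out // addr0 subrr rpred0.
  rewrite RC_d_bas //; last by rewrite -sz /= size_map.
  rewrite -[\sum_(_ < _) _]/(faces (bas R l) [:: piX x, x & xs]).
  rewrite !faces_cons /= expr1 scaleN1r !opprB !addrA.
  rewrite [X in X \in _](ACl ((1 * 6) * (2 * 5) * 4 * 3))%AC /=.
  rewrite !subrr !add0r.
  have /andP[By1 _] := By; have /andP[Bx1 Bxs] := Bx.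
  have /andP[yx _] := st.
  apply: submodB.
    apply: crit1_few_out By1 Bxs _ _ => //.
    apply: subseq_reach_sorted st.
    exact: (cat_subseq (subseq_refl [:: y]) (subseq_cons (map g xs) (g x))).
  apply: bas_few_out; rewrite /outs /= (exc_pi_in exc By1 Bx1 yx) add0n.
  exact: count_size.
- by rewrite linear0 faces0 scaler0 addr0 subrr rpred0.
Qed.

End Excision.

(** Splits x - d(hy + Sx), where h is [hinv], into the homotopy error at x, S(dx), h(dy - gx) and
    the failure of h to commute with d at y. *)
Fact excision_cancel_dom (V : zmodType) (t q p x l s : V) :
  x - (l + s) = x - s - t - q + t - (p - q) - (l - p).
Proof.
rewrite !opprB opprD !addrA.
rewrite [RHS](ACl (1 * 9 * 2 * (3 * 5) * (4 * 6) * (7 * 8)))%AC /=.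
by rewrite !addNr !addr0.
Qed.

Fact excision_cancel_cod (V : zmodType) (p y s e q : V) :
  y - s - (e + q) = y - s - p - e + (p - q).
Proof.
rewrite opprD !addrA [RHS](ACl (1 * 2 * 4 * 6 * (3 * 5)))%AC /=.
by rewrite addNr addr0.
Qed.

(** * Acyclicity of the cone by induction on outside entries *)

Section ExcisionCone.
Variables (R : pzRingType) (X P : digraph) (g : dhom X P).
Variables (BX : pred X) (piX : X -> X) (BP : pred P) (piP : P -> P).
Variable rho : P -> option X.
Hypothesis exc : excisive g BX piX BP piP rho.

Let GX := exc_X exc.
Let GP := exc_P exc.
Let lambda := hinv R piX BP rho.

Lemma hinv_short_or_few b c k z : z \in short_or_few R BP b c k ->
  lambda k z \in short_or_few R BX b c k.
Proof.
apply: short_or_few_linear => [p z'|t]; first exact: (hinv_F exc).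
have [ys [xs [e By Bx st _]]] := rtuple_split_out exc t.
rewrite free_lift_gen e !(rho_split exc) // outs_cat_in //.
rewrite {1}/outs -size_filter (all_filterP _) ?(all_out_map exc) // size_map.
move=> xc; case: ys By st {e} => [|y [|y' ys]] By st.
- apply: bas_few_out; exact: leq_trans (count_size _ _) xc.
- by have /andP[By1 _] := By; apply: (crit1_few_out R exc) By1 Bx st xc.
- exact: rpred0.
Qed.

Lemma hinv_d_short_or_few (k l : int) b c z : k = l + 1 ->
  z \in short_or_few R BP b c k ->
  RC_d R X k l (lambda k z) - lambda l (RC_d R P k l z)
  \in short_or_few R BX b c.-1 l.
Proof.
move=> kl.
pose op : {linear RCmod R P k -> RCmod R X l} :=
  (RC_d R X k l \o lambda k) \- (lambda l \o RC_d R P k l).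
apply: (short_or_few_linear (h := op)) => [p z' zp|t tc].
  by apply: submodB => //=; [apply/RC_Fd/(hinv_F exc)|apply/(hinv_F exc)/RC_Fd].
apply: gspan_sub (hinv_d R exc t kl) => s /leq_trans; apply.
by rewrite -!subn1 leq_sub2r.
Qed.

(** Relative acyclicity on absolute representatives: spans with c = 0 stand for F_b of the
    quotients. Subtracting the boundary of (v, w) removes one outside entry, and at c = 0 the zero
    witnesses suffice. *)
Lemma cone_absolute (a b : int) c (n0 n1 n2 : int)
    (x : RCmod R X n0) (y : RCmod R P n1) :
  n1 = n0 + 1 -> n2 = n1 + 1 ->
  x \in RC_F R X a n0 -> y \in RC_F R P a n1 ->
  x \in short_or_few R BX b c n0 -> y \in short_or_few R BP b c n1 ->
  (forall m, RC_d R X n0 m x \in short_or_few R BX b 0 m) ->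
  RC_d R P n1 n0 y - RCmap_fun R g n0 x \in short_or_few R BP b 0 n0 ->
  exists (v : RCmod R X n1) (w : RCmod R P n2),
    [/\ v \in RC_F R X a n1, w \in RC_F R P a n2,
        x - RC_d R X n1 n0 v \in short_or_few R BX b 0 n0
      & y - RC_d R P n2 n1 w - RCmap_fun R g n1 v
          \in short_or_few R BP b 0 n1].
Proof.
move=> n10 n21; elim: c x y => [|c IH] x y xF yF xc yc dx dyx.
  by exists 0, 0; split;
    rewrite ?rpred0 ?(linear0 (RC_d _ _ _ _)) ?(linear0 (RCmap_fun _ _ _)) ?subr0.
(* The contraction of the cone built from [hinv] and the two homotopies. *)
pose v := lambda n1 y + homotopy R BX piX n0 n1 x.
pose w := homotopy R BP piP n1 n2 y.
have vF : v \in RC_F R X a n1.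
  by apply: rpredD; [apply: (hinv_F exc)|apply: (homotopy_F GX)].
have wF : w \in RC_F R P a n2 by apply: (homotopy_F GP).
have n0E : n0 = n0 - 1 + 1 by lia.
have [||||||v' [w' [vF' wF' vE wE]]] := IH (x - RC_d R X n1 n0 v)
    (y - RC_d R P n2 n1 w - RCmap_fun R g n1 v).
- by apply: submodB => //; apply: RC_Fd.
- by do !apply: submodB => //; [apply: RC_Fd|apply: RCmap_F].
- rewrite /v linearD (excision_cancel_dom (homotopy R BX piX (n0 - 1) n0
    (RC_d R X n0 (n0 - 1) x)) (lambda n0 (RCmap_fun R g n0 x))
    (lambda n0 (RC_d R P n1 n0 y))).
  apply: submodB; last exact: (hinv_d_short_or_few n10 yc).
  apply: submodB; first apply: rpredD.
  + apply: (homotopy_retract GX (E := lambda n0 \o RCmap_fun R g n0)) xc => //.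
      exact: (hinv_RCmap R exc).
    by move=> p z zp; apply/(hinv_F exc)/RCmap_F.
  + by apply: short_or_few_mono (homotopy_short_or_few GX _ (dx _)).
  + rewrite -(linearB (lambda n0)).
    apply: short_or_few_mono (hinv_short_or_few dyx).
    exact: leq0n.
- rewrite /v linearD (RCmap_homotopy exc) (excision_cancel_cod
    (homotopy R BP piP n0 n1 (RC_d R P n1 n0 y))).
  apply: rpredD.
    apply: (homotopy_retract GP (E := RCmap_fun R g n1 \o lambda n1)) yc => //.
      exact: (RCmap_hinv R exc).
    by move=> p z zp; apply/RCmap_F/(hinv_F exc).
  rewrite -(linearB (homotopy R BP piP n0 n1)).
  apply: short_or_few_mono (homotopy_short_or_few GP _ dyx).
  exact: leq0n.
- by move=> m; rewrite linearB RC_dd subr0; apply: dx.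
- rewrite !(linearB (RC_d R P n1 n0)) (linearB (RCmap_fun R g n0)) RC_dd subr0.
  rewrite (RCmap_d g) opprB addrA subrK.
  exact: dyx.
exists (v + v'), (w + w'); split; [exact: rpredD|exact: rpredD| |].
- by rewrite linearD opprD addrA.
- rewrite (linearD (RC_d R P n2 n1)) (linearD (RCmap_fun R g n1)).
  move: wE; rewrite !opprD !addrA.
  by rewrite [X in X \in _ -> _](ACl (1 * 2 * 4 * 3 * 5))%AC.
Qed.

End ExcisionCone.

(** * The relative complexes *)

(** Reflecting reachability suffices to lift tuples; lengths are measured in X, since the filtration
    of the quotient is the image of that of RC(X). *)
Record reach_embedding (A X : digraph) (i : dhom A X) (B : pred X) : Prop :=
  ReachEmbedding {
    emb_in : forall a, B (i a);
    emb_onto : forall x, B x -> exists a, x = i a;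
    emb_reach : forall a a', reachable (i a) (i a') -> reachable a a'
  }.

Section Embedding.
Variables (R : pzRingType) (A X : digraph) (i : dhom A X) (B : pred X).
Hypothesis iB : reach_embedding i B.

Lemma emb_lift s : all B s -> exists s', s = map i s'.
Proof.
elim: s => [|x s IH] /=; first by exists [::].
by move=> /andP[/(emb_onto iB)[a ->] /IH[s' ->]]; exists (a :: s').
Qed.

Lemma emb_sorted s : sorted (@reachable X) (map i s) -> sorted (@reachable A) s.
Proof.
elim: s => [//|a [//|a' s] IH] /= /andP[aa' s_sorted].
by rewrite (emb_reach iB aa') /=; apply: IH.
Qed.

Lemma range_few_out n z :
  (z \in range_pred (RCmap R i n)) = (z \in few_out R B 0 n).
Proof.
apply/idP/idP => [/asboolP[y ->]|].
  rewrite [y]freemodE linear_sum; apply: rpred_sum => t _.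
  rewrite linearZ; apply: rpredZ; rewrite /= free_lift_gen; apply: bas_few_out.
  rewrite leqn0 /outs -leqn0 leqNgt -has_count -all_predC all_map.
  by apply/allP => a _ /=; rewrite (emb_in iB).
apply: (gspan_linear (h := idfun)) => t; rewrite leqn0 /outs => /eqP t0.
have /emb_lift[s e] : all B t.
  apply/allP => x xt; apply: contraT => Bx.
  have : has (predC B) t by apply/hasP; exists x.
  by rewrite has_count t0.
apply/asboolP; exists (bas R n s); rewrite /= -bas_rtuple e; apply/esym.
by apply: RCmap_bas; apply: emb_sorted; rewrite -e; apply: rtuple_sorted.
Qed.

(** The preimage of F_b of the quotient is F_b + RC(A), and RC(A) is spanned by the tuples without
    outside entries. *)
Lemma coker_F_short b n (z : RCmod R X n) :
  (\pi_(coker_obj (RCmap R i) n) z \in coker_F (RCmap R i) b n)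
  = (z \in short_or_few R B b 0 n).
Proof.
apply/idP/idP => [/asboolP[y yF /eqP]|].
  move=> /eqP/lquotP; rewrite range_few_out => zy.
  by rewrite -[z](subrK y); apply: rpredD; [apply: few_span|apply: short_span].
move=> /gspan_split[z1 [z2 [z1F z2W ->]]]; apply/asboolP; exists z1 => //.
by apply/lquotP; rewrite addrC addKr range_few_out.
Qed.

End Embedding.

Section RelativeExcision.
Variables (R : pzRingType) (A X Y P : digraph).
Variables (i : dhom A X) (f : dhom A Y) (g : dhom X P) (j : dhom Y P).
Hypothesis sq : forall a, g (i a) = j (f a).
Variables (BX : pred X) (piX : X -> X) (BP : pred P) (piP : P -> P).
Variable rho : P -> option X.
Hypotheses (iB : reach_embedding i BX) (jB : reach_embedding j BP).
Hypothesis exc : excisive g BX piX BP piP rho.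

Lemma RCrel_cone_acyclic a b : cone_acyclic (RCrel_map R sq) a b.
Proof.
move=> n0 n1 n2 n10 n21 _ _ /asboolP[x xF ->] /asboolP[y yF ->] dx dyx.
pose c := addn (absz (n0 + 1)) (absz (n1 + 1)).
have [||||||v [w [vF wF vE wE]]] :=
  @cone_absolute R _ _ _ _ _ _ _ _ exc a b c _ _ n2 x y n10 n21.
- exact: xF.
- exact: yF.
- by apply: short_or_few_mono (all_few _ _ _); apply: leq_addr.
- by apply: short_or_few_mono (all_few _ _ _); apply: leq_addl.
- move=> m; rewrite -(coker_F_short iB); have := dx m.
  rewrite /= /lquot_pi.
  by rewrite (lquot_mapE (@coker_d_subproof _ _ _ (RCmap R i) n0 m)).
- rewrite -(coker_F_short jB); move: dyx; rewrite /= /lquot_pi.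
  rewrite (lquot_mapE (@coker_d_subproof _ _ _ (RCmap R j) n1 n0)).
  rewrite (lquot_mapE (@coker_map_subproof _ _ _ _ _ _ _ _ _
    (@RCmap_square R _ _ _ _ _ _ _ _ sq) n0)).
  by rewrite -(linearB (lquot_pi _)).
exists (lquot_pi _ v), (lquot_pi _ w); split.
- by apply/asboolP; exists v.
- by apply/asboolP; exists w.
- move: vE; rewrite -(coker_F_short iB) /= /lquot_pi.
  rewrite (lquot_mapE (@coker_d_subproof _ _ _ (RCmap R i) n1 n0)).
  by rewrite [\pi_(_) (_ - _)](linearB (lquot_pi _)).
- move: wE; rewrite -(coker_F_short jB) /= /lquot_pi.
  rewrite (lquot_mapE (@coker_d_subproof _ _ _ (RCmap R j) n2 n1)).
  rewrite (lquot_mapE (@coker_map_subproof _ _ _ _ _ _ _ _ _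
    (@RCmap_square R _ _ _ _ _ _ _ _ sq) n1)).
  by rewrite [\pi_(_) (_ - _)](linearB (lquot_pi _)) (linearB (lquot_pi _)).
Qed.

End RelativeExcision.

(** * Cofibrations and pushouts *)

Section DistanceStep.
Variable G : digraph.
Implicit Types x y z : G.

Lemma dist_refl x : dist x x = Some 0%N.
Proof.
have : ele (dist x x) (Some 0%N) by apply: walk_dist; exists [::].
by case: (dist x x) => [[]|].
Qed.

Lemma dist_edge x y z n : edge x y -> ele (dist y z) (Some n) ->
  ele (dist x z) (Some n.+1).
Proof.
move=> xy; case yz: (dist y z) => [m|] // mn.
apply: (@ele_trans (Some m.+1)) => //; apply: walk_dist.
have [p [pp lp sp]] := dist_walk yz.
by exists (y :: p); rewrite /= xy pp lp sp.
Qed.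

Lemma ele_dist x y D :
  (forall p, path (@edge G) x p -> last x p = y -> ele D (Some (size p))) ->
  ele D (dist x y).
Proof.
move=> h; case xy: (dist x y) => [n|]; last by case: (D).
by have [p [pp lp <-]] := dist_walk xy; apply: h.
Qed.

Lemma reachableP x y : reflect (exists2 p, path (@edge G) x p & last x p = y)
  (reachable x y).
Proof.
apply: (iffP idP) => [|[p pp lp]].
  rewrite /reachable; case xy: (dist x y) => [n|] // _.
  by have [p [pp lp _]] := dist_walk xy; exists p.
have : ele (dist x y) (Some (size p)) by apply: walk_dist; exists p.
by rewrite /reachable; case: (dist x y).
Qed.

End DistanceStep.

Section Cofibration.
Variables (A X : digraph) (i : dhom A X).
Hypothesis hi : is_cofibration i.

Definition image : pred X := fun x => `[< exists a, x = i a >].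

Lemma image_in a : image (i a).
Proof. by apply/asboolP; exists a. Qed.

Lemma path_out x p : ~~ image x -> path (@edge X) x p -> ~~ image (last x p).
Proof.
elim: p x => [//|z p IH] x Bx /= /andP[xz zp]; apply: IH zp.
apply/negP => /asboolP[a za]; move: xz; rewrite za.
by apply/negP; apply: (cofib_no_edge hi) => -[b xb]; rewrite xb image_in in Bx.
Qed.

(** A path between vertices of A never leaves A, as it could not return; its edges come from A
    because the subgraph is induced. *)
Lemma cofib_reach_embedding : reach_embedding i image.
Proof.
split; [exact: image_in | by move=> x /asboolP |].
move=> a a' /reachableP[p pp lp]; apply/reachableP.
elim: p a pp lp => [|z p IH] a /=.
  by move=> _ /(cofib_inj hi) <-; exists [::].
move=> /andP[az zp] lp; have /asboolP[b zb] : image z.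
  by apply: contraT => /path_out/(_ zp); rewrite lp image_in.
rewrite {}zb in az zp lp; have [q bq lq] := IH _ zp lp.
by exists (b :: q); rewrite //= -(cofib_induced hi) az.
Qed.

Definition projection_spec (pi : X -> X) := forall x,
  (exists a, reachable (i a) x) -> exists2 b, pi x = i b &
    forall a, dist (i a) x = eadd (dist (i a) (i b)) (dist (i b) x).

Lemma projection_exists : exists pi, projection_spec pi.
Proof.
suff /choice[pi piP] : forall x, exists x', (exists a, reachable (i a) x) ->
    exists2 b, x' = i b &
    forall a, dist (i a) x = eadd (dist (i a) (i b)) (dist (i b) x).
  by exists pi.
move=> x.
have [/(cofib_proj hi)[b hb]|nx] := pselect (exists a, reachable (i a) x).
  by exists (i b) => _; exists b.
(* Outside the reach of A the projection is arbitrary. *)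
by exists x.
Qed.

Lemma cofib_retract pi : projection_spec pi -> reach_retract image pi.
Proof.
move=> piP; split.
- by move=> x y Bx /reachableP[p pp <-]; apply: path_out.
- move=> _ x /asboolP[a ->] _ ax; have [|b -> _] := piP x; first by exists a.
  exact: image_in.
- move=> _ x /asboolP[a ->] _ ax; have [|b -> bE] := piP x; first by exists a.
  by rewrite -bE ele_refl.
Qed.

End Cofibration.

(** * Distances in the pushout *)

Section Pushout.
Variables (A X Y P : digraph).
Variables (i : dhom A X) (f : dhom A Y) (g : dhom X P) (j : dhom Y P).
Hypotheses (hi : is_cofibration i) (hP : is_pushout i f g j).

(* The vertices inr (i a) are junk: only the map into this graph given by the
   universal property of P is used. *)
Definition glue_edge (q q' : Y + X) : bool :=
  match q, q' with
  | inl y, inl y' => edge y y'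
  | inl y, inr x => `[< exists2 a, f a = y & edge (i a) x >]
  | inr x, inr x' => edge x x'
  | inr _, inl _ => false
  end.
Definition glue : digraph := Digraph glue_edge.

Definition glue_map_fun (x : X) : glue :=
  if pselect (exists a, x = i a) is left e then inl (f (projT1 (cid e)))
  else inr x.

Lemma glue_map_in a : glue_map_fun (i a) = inl (f a).
Proof.
rewrite /glue_map_fun; case: pselect => [e|[]]; last by exists a.
by case: (cid e) => b /= /(cofib_inj hi) ->.
Qed.

Lemma glue_map_out x : ~~ image i x -> glue_map_fun x = inr x.
Proof.
by rewrite /glue_map_fun; case: pselect => // e /asboolP.
Qed.

Lemma glue_map_dhom x y : edge x y ->
  (glue_map_fun x == glue_map_fun y) || edge (glue_map_fun x) (glue_map_fun y).
Proof.
move=> xy; have [/asboolP[a xa]|Bx] := boolP (image i x); last first.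
  have By : ~~ image i y.
    by have := path_out hi Bx (p := [:: y]); rewrite /= xy; apply.
  by rewrite !glue_map_out // orbC /= xy.
have [/asboolP[b yb]|By] := boolP (image i y); last first.
  rewrite (glue_map_out By) xa glue_map_in; apply/orP; right => /=.
  by apply/asboolP; exists a; rewrite -?xa.
rewrite xa yb !glue_map_in; rewrite xa yb (cofib_induced hi) in xy.
exact: (dhomP f xy).
Qed.

Definition glue_map : dhom X glue := DHom glue_map_dhom.

Lemma glue_inl_dhom (y y' : Y) : edge y y' ->
  (inl y == inl y' :> glue) || edge (inl y : glue) (inl y').
Proof. by move=> yy'; rewrite orbC /= yy'. Qed.
Definition glue_inl : dhom Y glue := DHom glue_inl_dhom.

Lemma glue_path_inr (q : glue) p x :
  path (@edge glue) q p -> last q p = inr x ->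
  match q with
  | inl y => exists a, ele (eadd (dist y (f a)) (dist (i a) x)) (Some (size p))
  | inr x0 => ele (dist x0 x) (Some (size p))
  end.
Proof.
elim: p q => [|q' p IH] q /=; first by move=> _ ->; rewrite dist_refl.
move=> /andP[qq' q'p] /(IH _ q'p); case: q q' qq' {q'p} => [y|x0] [y'|x1] //=.
- move=> yy' [a]; case y'a: (dist y' (f a)) => [m|] //.
  case ax: (dist (i a) x) => [n|] // mn; exists a; rewrite ax.
  have : ele (dist y (f a)) (Some m.+1).
    by apply: dist_edge yy' _; rewrite y'a ele_refl.
  by case: (dist y (f a)) => //= k km; apply: leq_trans (leq_add km (leqnn n)) _.
- move=> /asboolP[a <- ax1] x1x; exists a; rewrite dist_refl.
  by have := dist_edge ax1 x1x; case: (dist (i a) x).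
- exact: dist_edge.
Qed.

Lemma glue_path_inl (q : glue) p y' :
  path (@edge glue) q p -> last q p = inl y' ->
  if q is inl y then ele (dist y y') (Some (size p)) else false.
Proof.
elim: p q => [|q' p IH] q /=; first by move=> _ ->; rewrite dist_refl.
move=> /andP[qq' q'p] /(IH _ q'p); case: q q' qq' {q'p} => [y|x0] [y1|x1] //=.
exact: dist_edge.
Qed.

(** Maps never increase distances: [w] bounds those of P from below, while [g] and [j] bound them
    from above. *)
Lemma glue_exists : exists w : dhom P glue,
  (forall x, w (g x) = glue_map_fun x) /\ (forall y, w (j y) = inl y).
Proof.
have [|w [wg wj _]] := pushout_univ hP (u := glue_map) (v := glue_inl).
  exact: glue_map_in.
by exists w.
Qed.

(** Every function to the complete graph with loops on two vertices is a map. The indicator of the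
    union of the images and the constant [true] agree on X and Y, hence on P by uniqueness. *)
Lemma pushout_surj z : (exists x, z = g x) \/ (exists y, z = j y).
Proof.
pose two := Digraph (vert := bool) (fun _ _ => true).
have two_dhom (G : digraph) (h : G -> two) (x y : G) : edge x y ->
  (h x == h y) || edge (h x) (h y) by move=> _; rewrite orbT.
pose cst (G : digraph) := DHom (two_dhom G (fun=> true)).
pose im := DHom (two_dhom P
  (fun z => `[< (exists x, z = g x) \/ (exists y, z = j y) >])).
have [//|w [_ _ wE]] := pushout_univ hP (u := cst X) (v := cst Y).
have imE : im z = true.
  rewrite wE; first by rewrite -(wE (cst P)).
  - by move=> x; apply/asboolP; left; exists x.
  - by move=> y; apply/asboolP; right; exists y.
exact: (asboolW imE).
Qed.

Lemma pushout_excisive : exists BX piX BP piP rho,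
  [/\ reach_embedding i BX, reach_embedding j BP
    & excisive g BX piX BP piP rho].
Proof.
have [w [wg wj]] := glue_exists; have [piX piXE] := projection_exists hi.
have w_path p q : reachable p q -> exists s,
    [/\ path (@edge glue) (w p) s, last (w p) s = w q
      & ele (Some (size s)) (dist p q)].
  rewrite /reachable; have := dhom_dist w p q.
  case: (dist p q) => [n|//]; case wpq: (dist _ _) => [m|//] mn _.
  by have [s [ps ls sm]] := dist_walk wpq; exists s; rewrite sm.
pose BP : pred P := fun z => if w z is inl _ then true else false.
pose rho z := if w z is inr x then Some x else None.
(* The value [z] on the part coming from Y is a filler. *)
pose piP z := if w z is inr x then g (piX x) else z.
have BP_g x : BP (g x) = image i x.
  rewrite /BP wg; have [/asboolP[a ->]|Bx] := boolP (image i x).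
    by rewrite glue_map_in.
  by rewrite glue_map_out.
have BP_j y : BP (j y) by rewrite /BP wj.
have BP_onto z : BP z -> exists y, z = j y.
  have [[x ->]|//] := pushout_surj z.
  rewrite BP_g => /asboolP[a ->]; exists (f a); exact: (pushout_sq hP).
have w_out x : ~~ image i x -> w (g x) = inr x.
  by move=> Bx; rewrite wg glue_map_out.
(* A path in [glue] crosses from [f a] along an edge out of [i a]; the cofibration then factors the
   distance from [i a] to [x] through [i b = piX x]. *)
have jx_dist y x : ~~ image i x -> reachable (j y) (g x) ->
    exists a b, [/\ piX x = i b, reachable (i a) x &
      ele (eadd (dist y (f a)) (eadd (dist (i a) (i b)) (dist (i b) x)))
        (dist (j y) (g x))].
  move=> Bx /w_path[s []]; rewrite wj w_out // => ps ls sn.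
  have [a aD] := glue_path_inr ps ls; exists a.
  have ax : reachable (i a) x.
    move: aD; rewrite /reachable.
    by case: (dist y _) => // m; case: (dist (i a) x).
  have [|b piE bE] := piXE x; first by exists a.
  by exists b; split=> //; rewrite -bE; apply: ele_trans aD sn.
have jB : reach_embedding j BP.
  split=> // y y' /w_path[s []]; rewrite !wj => ps ls _.
  have := glue_path_inl ps ls; rewrite /reachable; by case: (dist y y').
have BP_out z : ~~ BP z -> exists2 x, ~~ image i x & z = g x.
  have [[x ->]|[y ->]] := pushout_surj z; last by rewrite BP_j.
  by rewrite BP_g => Bx; exists x.
exists (image i), piX, BP, piP, rho; split=> //.
  exact: cofib_reach_embedding.
have piP_g x : ~~ image i x -> piP (g x) = g (piX x).
  by move=> Bx; rewrite /piP w_out.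
split=> //.
- exact: cofib_retract.
- split.
  + move=> z z' /BP_out[x Bx ->] /w_path[s []]; rewrite w_out // => ps ls _.
    apply/negP => /BP_onto[y zE]; move: ls; rewrite zE wj.
    by move=> /(glue_path_inl ps).
  + move=> _ _ /BP_onto[y ->] /BP_out[x Bx ->].
    move=> /(jx_dist _ _ Bx)[a [b [piE _ _]]].
    by rewrite piP_g // piE (pushout_sq hP).
  + move=> _ _ /BP_onto[y ->] /BP_out[x Bx ->] /(jx_dist _ _ Bx)[a [b [piE _]]].
    apply: ele_trans; rewrite piP_g // piE eaddA; apply: ele_add; last first.
      exact: dhom_dist.
    (* The projection is reached through [j (f a) = g (i a)]: the first leg is an image under [j],
       the second under [g]. *)
    apply: ele_trans (dist_triangle _ (j (f a)) _) _; apply: ele_add.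
      exact: dhom_dist.
    by rewrite -(pushout_sq hP); apply: dhom_dist.
- by move=> z; rewrite /BP /rho; case: (w z).
- by move=> x Bx; rewrite /rho w_out.
- move=> x x' Bx Bx'; apply: ele_trans (dhom_dist w _ _).
  by apply: ele_dist => s; rewrite !w_out //; apply: glue_path_inr.
- move=> _ x /BP_onto[y ->] Bx /(jx_dist _ _ Bx)[a [b [-> _]]].
  by apply: ele_trans; apply: ele_trans (ele_addl _ _); apply: ele_addl.
- move=> _ x /BP_onto[y ->] Bx /(jx_dist _ _ Bx)[a [b [-> _ _]]].
  exact: image_in.
Qed.

End Pushout.

Theorem theorem6p5 (R : comPzRingType) (A X Y P : digraph)
    (i : dhom A X) (f : dhom A Y) (g : dhom X P) (j : dhom Y P)
    (hi : is_cofibration i) (hP : is_pushout i f g j) :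
  (forall r : nat, (1 <= r)%N -> forall p q : int,
     bijective (MPSS_map R (pushout_sq hP) r p q)) /\
  (forall k l : int, bijective (MH_map R (pushout_sq hP) k l)) /\
  (forall k l : int, bijective (PH_map R (pushout_sq hP) k l)).
Proof.
have [BX [piX [BP [piP [rho [iB jB exc]]]]]] := pushout_excisive hi hP.
have main r : (1 <= r)%N -> forall p q : int,
    bijective (MPSS_map R (pushout_sq hP) r p q).
  move=> r_gt0 p q; apply: Epage_map_bij => // a b _.
  exact: (@RCrel_cone_acyclic _ _ _ _ _ _ _ _ _ _ _ _ _ _ _ iB jB exc a b).
(* Magnitude and bigraded path homology are the pages r = 1 and r = 2, reindexed. *)
by split; [exact: main|split=> k l; exact: main].
Qed.
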